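(* Suppose that the joint process $(S,C)=(S_n,C_n)_{n\ge 0}$, with $S_n\in\mathbb R$ and $C_n\in\mathbb R^{\ell}$, has i.i.d. increments. Then, for any $t\in\mathbb R$, $s\in\mathbb R^{\ell}$ and $z\in(0,1)$, $$\mathbb{E}\left[ z^{\mathcal T} e^{i t S_{\mathcal T}} e^{i s\cdot C_{\mathcal T}} \right] = 1-\exp \left(-\sum_{n=1}^{\infty} \frac{z^{n}}{n} \int_{\{S_{n} > 0\}} e^{i t S_{n}}e^{i s \cdot C_{n}}\, d \mathbb{P}\right)$$ and $$\mathbb{E}\left[\sum_{n=0}^{\mathcal T-1} z^{n} e^{i t S_{n}} e^{i s\cdot C_{n}} \right] =\exp \left( \sum_{n=1}^{\infty} \frac{z^{n}}{n} \int_{ \{ S_{n} \le 0 \}} e^{i t S_{n}}e^{i s \cdot C_{n}}\, d \mathbb{P}\right).$$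
   Context: Fix $\ell\in\mathbb N$. $S=(S_n)_{n\ge0}$ is a real-valued process (control process) and $C=(C_n)_{n\ge0}$ an $\mathbb R^\ell$-valued process (cost process), which may depend on $S$, with $S_0=0$, $C_0=0$. ''I.i.d. increments'' means $S_n=\sum_{k=1}^n\xi_k$, $C_n=\sum_{k=1}^n\eta_k$ where the pairs $(\xi_k,\eta_k)_{k\ge1}$ are i.i.d. in $\mathbb R\times\mathbb R^\ell$; $\xi_k$ and $\eta_k$ need not be independent of each other. The first-ladder time is $\mathcal T=\min\{n>0: S_n>0\}$ (with $\mathcal T=\infty$ if the set is empty; on $\{\mathcal T=\infty\}$ the quantity $z^{\mathcal T}e^{itS_{\mathcal T}}e^{is\cdot C_{\mathcal T}}$ is taken to be $0$). *)

(* Defs.v *)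
From HB Require Import structures.
From mathcomp Require Import all_boot all_order all_algebra.
From mathcomp Require Import finmap.
From mathcomp Require Import all_classical all_reals all_analysis.
From mathcomp Require Import complex.

Set Implicit Arguments.
Unset Strict Implicit.
Unset Printing Implicit Defensive.

Import Order.TTheory GRing.Theory Num.Theory.
Import numFieldNormedType.Exports.

Local Open Scope classical_set_scope.
Local Open Scope ring_scope.
Local Open Scope complex_scope.

(* The sigma-algebra on row vectors generated by the coordinates, i.e. the
   Borel sigma-algebra of R^l (as for tuples in the library). *)
Section measurable_rV.
Context (R : realType) (l : nat).

Let coord (i : 'I_l) (x : 'rV[R]_l) : R := x ord0 i.

Let rV_set0 : g_sigma_preimage coord set0.
Proof. exact: sigma_algebra0. Qed.

Let rV_setC A : g_sigma_preimage coord A -> g_sigma_preimage coord (~` A).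
Proof. exact: sigma_algebraC. Qed.

Let rV_bigcup (F : (set 'rV[R]_l)^nat) :
  (forall i, g_sigma_preimage coord (F i)) ->
  g_sigma_preimage coord (\bigcup_i F i).
Proof. exact: sigma_algebra_bigcup. Qed.

HB.instance Definition _ := @isMeasurable.Build default_measure_display
  'rV[R]_l (g_sigma_preimage coord) rV_set0 rV_setC rV_bigcup.

End measurable_rV.

Section complex_valued.
Context (R : realType).

(* e^(x + iy) = e^x (cos y + i sin y) *)
Definition cexp (w : R[i]) : R[i] :=
  (expR (complex.Re w))%:C * (cos (complex.Im w) +i* sin (complex.Im w)).

(* The modulus makes R[i] a numFieldType; the library puts the corresponding
   norm topology on the regular module R[i]^o. *)
Definition cseries_sum (m : nat) (u : nat -> R[i]) : R[i] :=
  limn (fun n => (\sum_(m <= k < n) u k : R[i]^o)).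

Definition cintegral d (T : measurableType d) (mu : {measure set T -> \bar R})
    (D : set T) (f : T -> R[i]) : R[i] :=
  (\int[mu]_(x in D) complex.Re (f x)) +i* (\int[mu]_(x in D) complex.Im (f x)).

End complex_valued.

Section iid.
Context d (T : measurableType d) (R : realType) (P : probability T R).

Definition mutually_independent d' (E : measurableType d')
    (X : nat -> {RV P >-> E}) : Prop :=
  forall (J : {fset nat}) (B : nat -> set E),
    (forall k, measurable (B k)) ->
    P (\bigcap_(k in [set` J]) (X k @^-1` B k)) =
    (\prod_(k <- J) P (X k @^-1` B k))%E.

Definition identically_distributed d' (E : measurableType d')
    (X : nat -> {RV P >-> E}) : Prop :=
  forall (j k : nat) (B : set E), measurable B ->
    distribution P (X j) B = distribution P (X k) B.

(* X k is the pair (xi_(k+1), eta_(k+1)): the increments are indexed from 0. *)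
Definition iid_increments (l : nat)
    (S : nat -> T -> R) (C : nat -> T -> 'rV[R]_l) : Prop :=
  exists X : nat -> {RV P >-> (R * 'rV[R]_l)%type},
    [/\ mutually_independent X, identically_distributed X,
        forall n x, S n x = \sum_(k < n) (X k x).1 &
        forall n x, C n x = \sum_(k < n) (X k x).2].

End iid.

(* None stands for the value infinity. *)
Definition ladder_time (T : Type) (R : realType) (S : nat -> T -> R) (x : T) :
    option nat :=
  if pselect (exists n, (0 < n)%N && (0 < S n x)) is left ex
  then Some (ex_minn ex) else None.

Definition dotmul (R : realType) (l : nat) (u v : 'rV[R]_l) : R :=
  \sum_(i < l) u ord0 i * v ord0 i.

(* e^(itS_n) e^(is.C_n) *)
Definition joint_char (T : Type) (R : realType) (l : nat)
    (S : nat -> T -> R) (C : nat -> T -> 'rV[R]_l) (t : R) (s : 'rV[R]_l)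
    (n : nat) (x : T) : R[i] :=
  cexp (0 +i* (t * S n x)) * cexp (0 +i* dotmul s (C n x)).

(* Main.v *)
(* Write b_n = E[chi_n; T > n], q_n = E[chi_n; S_n <= 0] and phi = E[chi_1],
   where chi_n = exp (i t S_n + i s.C_n) and T is the first-ladder time.
   Restriction of measures to {S <= 0} is a Rota-Baxter operator on the
   convolution algebra, and b_n is obtained from b_(n-1) by multiplying with the
   law of an increment and restricting; an induction then gives
     n b_n = \sum_(1 <= k <= n) q_k b_(n-k).
   For the generating functions this is the differential equation B' = Q' B with
   Q = \sum_n q_n z^n / n, so B = exp Q, which is the second identity.  The same
   equation for phi^n gives 1 - z phi = exp (- \sum_n phi^n z^n / n), and
   b_n phi = b_(n+1) + E[chi_(n+1); T = n+1] turns E[z^T chi_T] into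
   1 - B (1 - z phi), which is the first identity. *)

Require Import Defs.
From HB Require Import structures.
From mathcomp Require Import all_boot all_order all_algebra.
From mathcomp Require Import finmap.
From mathcomp Require Import all_classical all_reals all_analysis.
From mathcomp Require Import measurable_realfun.
From mathcomp Require Import complex ring lra zify.

Set Implicit Arguments.
Unset Strict Implicit.
Unset Printing Implicit Defensive.

Import Order.TTheory GRing.Theory Num.Theory.
Import numFieldNormedType.Exports.

Local Open Scope classical_set_scope.
Local Open Scope ring_scope.
Local Open Scope complex_scope.

(** * Real and imaginary parts *)

(** No convolution algebra is constructed: a finite measure on R x R is represented by its action on
    bounded measurable functions [h], convolution by nested integrals of [h (w + v)], and
    restriction by multiplication with [nonpos]. The Rota-Baxter property then is a pointwise
    identity between indicators, and commutativity of convolution is Fubini. Two coordinates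
    suffice: the control, whose sign decides survival, and the phase t S + s.C.

    The differential equation is not solved among power series either. Truncation at degree N leaves
    polynomials that satisfy B' = Q' B up to terms of degree at least N; on [0, z] this defect is
    O(N^2 z^N), so by the mean value theorem B exp (- Q) tends at z to its value 1 at 0. The
    argument asks for coefficients with parts bounded by 1, hence serves b_n and phi^n alike and
    replaces a complex logarithm of 1 - z phi. *)

Section complex_parts.
Variable R : realType.
Implicit Types x y : R[i].

Lemma ReD x y : complex.Re (x + y) = complex.Re x + complex.Re y.
Proof. by case: x y => [? ?] [? ?]. Qed.

Lemma ImD x y : complex.Im (x + y) = complex.Im x + complex.Im y.
Proof. by case: x y => [? ?] [? ?]. Qed.

Lemma ReN x : complex.Re (- x) = - complex.Re x.
Proof. by case: x. Qed.

Lemma ImN x : complex.Im (- x) = - complex.Im x.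
Proof. by case: x. Qed.

Lemma ReM x y : complex.Re (x * y) =
  complex.Re x * complex.Re y - complex.Im x * complex.Im y.
Proof. by case: x y => [? ?] [? ?]. Qed.

Lemma ImM x y : complex.Im (x * y) =
  complex.Re x * complex.Im y + complex.Im x * complex.Re y.
Proof. by case: x y => [? ?] [? ?]. Qed.

Lemma Re_sum (I : Type) (s : seq I) (P : pred I) (F : I -> R[i]) :
  complex.Re (\sum_(i <- s | P i) F i) = \sum_(i <- s | P i) complex.Re (F i).
Proof. exact: (big_morph _ ReD). Qed.

Lemma Im_sum (I : Type) (s : seq I) (P : pred I) (F : I -> R[i]) :
  complex.Im (\sum_(i <- s | P i) F i) = \sum_(i <- s | P i) complex.Im (F i).
Proof. exact: (big_morph _ ImD). Qed.

Lemma Re_scale (r : R) x : complex.Re (r%:C * x) = r * complex.Re x.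
Proof. by rewrite ReM mul0r subr0. Qed.

Lemma Im_scale (r : R) x : complex.Im (r%:C * x) = r * complex.Im x.
Proof. by rewrite ImM mul0r addr0. Qed.

Lemma complex_natr n : (n%:R : R[i]) = (n%:R : R)%:C.
Proof. by rewrite rmorph_nat. Qed.

Lemma complex_eq x y : complex.Re x = complex.Re y ->
  complex.Im x = complex.Im y -> x = y.
Proof. by case: x y => [? ?] [? ?] /= -> ->. Qed.

End complex_parts.

(** * Bounded measurable functions *)

(** Rectangles are stable under intersection and generate the product sigma-algebra. The whole space
    is one of them, so the exhausting sequence can be constant. *)
Lemma eq_measure_rectangles d1 d2 (T1 : measurableType d1)
    (T2 : measurableType d2) (R : realType)
    (m1 m2 : {measure set (T1 * T2) -> \bar R}) :
  (m1 setT < +oo)%E ->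
  (forall A B, measurable A -> measurable B ->
    m1 (A `*` B) = m2 (A `*` B)) ->
  forall D, measurable D -> m1 D = m2 D.
Proof.
move=> fin_m1 m12 D mD.
pose C : set (set (T1 * T2)) :=
  [set C | exists A, measurable A /\ exists B, measurable B /\ C = A `*` B].
apply: (measure_unique C (fun=> setT)) => //.
- rewrite measurable_prod_measurableType //; congr (<<s _ >>).
  rewrite predeqE; split => [[A mA [B mB <-]]|[A [mA [B [mB ->]]]]].
    by exists A; split => //; exists B.
  by exists A => //; exists B.
- move=> _ _ [X1 [mX1 [X2 [mX2 ->]]]] [Y1 [mY1 [Y2 [mY2 ->]]]].
  rewrite -setXI; exists (X1 `&` Y1); split; first exact: measurableI.
  by exists (X2 `&` Y2); split => //; exact: measurableI.
- by move=> n; exists setT; split => //; exists setT; rewrite setXTT.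
- by apply/seteqP; split=> x _ //; exists 0%N.
- by move=> _ [A [mA [B [mB ->]]]]; exact: m12.
Qed.

Section bounded_measurable.
Context d (T : measurableType d) (R : realType).
Implicit Types f g : T -> R.

Definition bmf f := measurable_fun setT f /\ exists K, forall x, `|f x| <= K.

Lemma bmf_cst (r : R) : bmf (fun=> r).
Proof. by split=> //; exists `|r|. Qed.

Lemma bmfD f g : bmf f -> bmf g -> bmf (fun x => f x + g x).
Proof.
move=> [mf [K fK]] [mg [L gL]]; split; first exact: measurable_funD.
by exists (K + L) => x; rewrite (le_trans (ler_normD _ _))// lerD.
Qed.

Lemma bmfM f g : bmf f -> bmf g -> bmf (fun x => f x * g x).
Proof.
move=> [mf [K fK]] [mg [L gL]]; split; first exact: measurable_funM.
by exists (K * L) => x; rewrite normrM ler_pM.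
Qed.

Lemma bmfB f g : bmf f -> bmf g -> bmf (fun x => f x - g x).
Proof.
move=> bf bg; rewrite (_ : (fun _ => _) = (fun x => f x + (-1) * g x)).
  by apply: bmfD => //; apply: bmfM => //; exact: bmf_cst.
by apply/funext => x; rewrite mulN1r.
Qed.

Lemma bmf_sum (I : Type) (s : seq I) (f : I -> T -> R) :
  (forall i, bmf (f i)) -> bmf (fun x => \sum_(i <- s) f i x).
Proof.
move=> bf; elim: s => [|i s ih].
  by under eq_fun do rewrite big_nil; exact: bmf_cst.
by under eq_fun do rewrite big_cons; exact: bmfD.
Qed.

Lemma bmf_integrable (P : probability T R) f : bmf f ->
  P.-integrable setT (EFin \o f).
Proof.
move=> [mf [K fK]]; apply: measurable_bounded_integrable => //.
  by rewrite [X in (X < _)%E]probability_setT ltry.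
exists K; split; first exact: num_real.
by move=> M KM x _; apply: le_trans (fK x) (ltW KM).
Qed.

End bounded_measurable.

Lemma bmf_comp d1 d2 (T1 : measurableType d1) (T2 : measurableType d2)
    (R : realType) (f : T2 -> R) (g : T1 -> T2) :
  bmf f -> measurable_fun setT g -> bmf (fun x => f (g x)).
Proof.
move=> [mf [K fK]] mg; split; first exact: measurableT_comp mf mg.
by exists K.
Qed.

Section expectation.
Context d (T : measurableType d) (R : realType) (P : probability T R).
Implicit Types f g : T -> R.

Lemma expectD f g : bmf f -> bmf g ->
  \int[P]_x (f x + g x) = \int[P]_x f x + \int[P]_x g x.
Proof. by move=> bf bg; rewrite RintegralD//; exact: bmf_integrable. Qed.

Lemma expectB f g : bmf f -> bmf g ->
  \int[P]_x (f x - g x) = \int[P]_x f x - \int[P]_x g x.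
Proof. by move=> bf bg; rewrite RintegralB//; exact: bmf_integrable. Qed.

Lemma expectZl (r : R) f : bmf f ->
  \int[P]_x (r * f x) = r * \int[P]_x f x.
Proof. by move=> bf; rewrite RintegralZl//; exact: bmf_integrable. Qed.

Lemma expectZr (r : R) f : bmf f ->
  \int[P]_x (f x * r) = \int[P]_x f x * r.
Proof. by move=> bf; rewrite RintegralZr//; exact: bmf_integrable. Qed.

Lemma expect_cst (r : R) : \int[P]_x r = r.
Proof. by rewrite Rintegral_cst// [X in fine X]probability_setT mulr1. Qed.

Lemma eq_expect f g : f =1 g -> \int[P]_x f x = \int[P]_x g x.
Proof. by move=> fg; apply: eq_Rintegral => x _; exact: fg. Qed.

Lemma expect_norm_le (K : R) f : bmf f -> (forall x, `|f x| <= K) ->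
  `|\int[P]_x f x| <= K.
Proof.
move=> bf fK; rewrite -[leRHS]expect_cst.
rewrite (le_trans (le_normr_Rintegral _ _))//; first exact: bmf_integrable.
apply: le_Rintegral => //; last exact: (bmf_integrable _ (bmf_cst _ _)).
apply: bmf_integrable; case: bf => mf _.
by split; [exact: measurableT_comp|exists K => x; rewrite normr_id].
Qed.

End expectation.

Section bounded_fubini.
Context d1 d2 (T1 : measurableType d1) (T2 : measurableType d2) (R : realType).
Variables (P1 : probability T1 R) (P2 : probability T2 R).
Implicit Type F : T1 * T2 -> R.

Lemma bmf_pair1 F x : bmf F -> bmf (fun y => F (x, y)).
Proof. by move=> bF; apply: (bmf_comp bF); exact: pair1_measurable. Qed.

Lemma bmf_pair2 F y : bmf F -> bmf (fun x => F (x, y)).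
Proof. by move=> bF; apply: (bmf_comp bF); exact: pair2_measurable. Qed.

Lemma EFin_expect d (T : measurableType d) (P : probability T R) (f : T -> R) :
  bmf f -> (\int[P]_x f x)%:E = (\int[P]_x (f x)%:E)%E.
Proof.
move=> bf; rewrite /Rintegral fineK//.
by apply: integrable_fin_num => //; exact: bmf_integrable.
Qed.

Lemma bmf_expect F : bmf F -> bmf (fun x => \int[P2]_y F (x, y)).
Proof.
move=> bF; have [mF [K FK]] := bF; split; last first.
  by exists K => x; apply: expect_norm_le => //; exact: bmf_pair1.
(* Tonelli gives measurability for nonnegative integrands; [F] is made nonnegative by adding its
   bound, which is subtracted again at the end. *)
have FK0 z : (0 <= (F z + K)%:E)%E.
  rewrite lee_fin -lerBlDr sub0r lerNl (le_trans _ (FK z))//.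
  by rewrite ler_normr lexx orbT.
have bFK : bmf (fun z => F z + K) by apply: bmfD => //; exact: bmf_cst.
have mG : measurable_fun setT (fun x => \int[P2]_y (F (x, y) + K)).
  apply/measurable_EFinP.
  rewrite (_ : _ \o _ = fubini_F P2 (EFin \o (fun z => F z + K))).
    apply: measurable_fun_fubini_tonelli_F => //.
    by apply/measurable_EFinP; case: bFK.
  apply/funext => x; rewrite /= EFin_expect//.
  exact: (bmf_pair1 (F := fun z => F z + K)).
rewrite (_ : (fun _ => _) = (fun x => \int[P2]_y (F (x, y) + K) - K)).
  exact: measurable_funB.
apply/funext => x; rewrite expectD ?expect_cst ?addrK//.
  exact: bmf_pair1.
exact: bmf_cst.
Qed.

Lemma expect_prod F : bmf F ->
  \int[P1]_x \int[P2]_y F (x, y) = \int[(P1 \x P2)%E]_z F z.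
Proof.
move=> bF; rewrite /Rintegral; congr fine.
have <- := integral12_prod_meas1 (bmf_integrable (P1 \x P2)%E bF).
apply: eq_integral => x _.
by rewrite EFin_expect//; exact: bmf_pair1.
Qed.

Lemma expectC F : bmf F ->
  \int[P1]_x \int[P2]_y F (x, y) = \int[P2]_y \int[P1]_x F (x, y).
Proof.
move=> bF; rewrite expect_prod// /Rintegral; congr fine.
have <- := integral21_prod_meas1 (bmf_integrable (P1 \x P2)%E bF).
apply: eq_integral => x _.
by rewrite EFin_expect//; exact: bmf_pair2.
Qed.

End bounded_fubini.

(** * Markov chains driven by i.i.d. variables *)

Section driven_chain.
Context d (T : measurableType d) (R : realType) (P : probability T R).
Context dE (E : measurableType dE) (X : nat -> {RV P >-> E}).
Hypotheses (indX : mutually_independent X) (idX : identically_distributed X).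
Context dM (M : measurableType dM) (step : M * E -> M) (y0 : M).
Hypothesis mstep : measurable_fun setT step.
Variable Y : nat -> T -> M.
Hypotheses (Y0 : forall x, Y 0 x = y0)
  (YS : forall n x, Y n.+1 x = step (Y n x, X n x)).

Lemma measurable_chain n : measurable_fun setT (Y n).
Proof.
elim: n => [|n ih]; first by rewrite (_ : Y 0 = cst y0)//; exact/funext.
rewrite (_ : Y n.+1 = step \o (fun x => (Y n x, X n x))); last first.
  by apply/funext => x; rewrite YS.
by apply: measurableT_comp => //; exact: measurable_fun_pair.
Qed.

Let future (J : {fset nat}) (B : nat -> set E) :=
  \bigcap_(k in [set` J]) (X k @^-1` B k).

Let measurable_future J B : (forall k, measurable (B k)) ->
  measurable (future J B).
Proof.
move=> mB; rewrite /future; apply: fin_bigcap_measurable => [|k _].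
  exact: finite_fset.
by rewrite -[X in measurable X]setTI; exact: measurable_funP.
Qed.

(* Quantifying over all finite sets J of later increments is what makes the
   induction on n go through; no sigma-algebra of the past is needed. *)
Lemma chain_independent_future n (J : {fset nat}) (B : nat -> set E)
    (A : set M) :
  (forall k, measurable (B k)) -> measurable A ->
  (forall k, k \in J -> (n <= k)%N) ->
  P (Y n @^-1` A `&` future J B) =
  (P (Y n @^-1` A) * \prod_(k <- J) P (X k @^-1` B k))%E.
Proof.
elim: n J B A => [|n ih] J B A mB mA nJ.
  have [yA|yA] := pselect (A y0).
    rewrite (_ : Y 0 @^-1` A = setT); last first.
      by apply/seteqP; split=> // x _ /=; rewrite Y0.
    by rewrite setTI probability_setT mul1e indX.
  rewrite (_ : Y 0 @^-1` A = set0); last first.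
    by apply/seteqP; split=> // x /=; rewrite Y0.
  by rewrite set0I measure0 mul0e.
have mF := measurable_future J mB.
pose YX x := (Y n x, X n x).
have mYX : measurable_fun setT YX.
  by apply: measurable_fun_pair; [exact: measurable_chain|].
have mY A' : measurable A' -> measurable (Y n @^-1` A').
  by move=> mA'; rewrite -[X in measurable X]setTI; exact: measurable_chain.
have p_ge0 : (0 <= \prod_(k <- J) P (X k @^-1` B k))%E.
  by apply: prode_ge0 => k _; exact: measure_ge0.
have p_fin : (\prod_(k <- J) P (X k @^-1` B k))%E \is a fin_num.
  rewrite -indX// fin_num_measure//.
pose p : {nonneg R} := NngNum (fine_ge0 p_ge0).
have pE : (p%:num)%:E = (\prod_(k <- J) P (X k @^-1` B k))%E by rewrite /= fineK.
(* [m1] is the law of (Y n, X n) on the future event, [m2] its law times the probability of that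
   event. As measures they can be compared on rectangles and then evaluated on the preimage of [A]
   under [step]. *)
pose m1 : {measure set (M * E) -> \bar R} :=
  measure_function_pushforward__canonical__measure_function_Measure
    (mrestr P mF) mYX.
pose m2 : {measure set (M * E) -> \bar R} :=
  mscale p (measure_function_pushforward__canonical__measure_function_Measure
    P mYX).
have m12 : forall D, measurable D -> m1 D = m2 D.
  apply: eq_measure_rectangles.
    rewrite /m1 /= /pushforward /mrestr.
    by rewrite ltey_eq fin_num_measure//; apply: measurableI => //;
      rewrite preimage_setT.
  move=> A1 B1 mA1 mB1; rewrite /m1 /m2 /= /mscale /= /pushforward /mrestr.
  have nJ' : n \notin J by apply/negP => /nJ; rewrite ltnn.
  (* Time n joins the finite set of later times, with event [B1]: the induction hypothesis, valid
     from n on, then also covers [X n]. *)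
  pose B' k := if k == n then B1 else B k.
  have mB' k : measurable (B' k) by rewrite /B'; case: ifP.
  have futureE K : n \notin K -> future (n |` K)%fset B' =
      X n @^-1` B1 `&` future K B.
    move=> nK; apply/seteqP; split=> x.
      move=> h; split; first by have := h n; rewrite /B' eqxx; apply;
        rewrite /= !inE eqxx.
      move=> k kK; have := h k; rewrite /B' ifF; first by apply;
        rewrite /= !inE kK orbT.
      by apply/eqP => kn; move: nK; rewrite -kn kK.
    move=> [xB h] k /=; rewrite !inE /B' => /orP[/eqP ->|kK].
      by rewrite eqxx.
    by case: ifP => [/eqP ->//|_]; exact: h.
  have prodE K : n \notin K -> (\prod_(k <- (n |` K)%fset) P (X k @^-1` B' k) =
      P (X n @^-1` B1) * \prod_(k <- K) P (X k @^-1` B k))%E.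
    move=> nK; rewrite big_fsetU1//= /B' eqxx; congr (_ * _)%E.
    rewrite big_seq [RHS]big_seq; apply: eq_bigr => k kK.
    by rewrite ifF//; apply/eqP => kn; move: nK; rewrite -kn kK.
  have key K : n \notin K -> (forall k, k \in K -> (n <= k)%N) ->
      P (YX @^-1` (A1 `*` B1) `&` future K B) =
      (P (Y n @^-1` A1) * (P (X n @^-1` B1) *
        \prod_(k <- K) P (X k @^-1` B k)))%E.
    move=> nK leK; rewrite -prodE// -ih//; last first.
      by move=> k; rewrite !inE => /orP[/eqP ->//|/leK].
    rewrite futureE// setIA; congr (P (_ `&` _)).
  (* With no later time, [key] factorizes the law of (Y n, X n) for the [m2] side; with [J] it
     computes the [m1] side. *)
  have := key fset0; rewrite /future set_fset0 bigcap_set0 setIT => -> //.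
  rewrite big_seq_fset0 mule1 key//; last by move=> k /nJ /ltnW.
  by rewrite fineK// muleA muleC.
have YSE : Y n.+1 @^-1` A = YX @^-1` (step @^-1` A).
  by apply/seteqP; split=> x /=; rewrite YS.
have mA' : measurable (step @^-1` A).
  by rewrite -[X in measurable X]setTI; exact: mstep.
have := m12 _ mA'; rewrite /m1 /m2 /= /mscale /= /pushforward /mrestr YSE => ->.
by rewrite fineK// muleC.
Qed.

(* By identical distribution X n may be replaced by an independent copy of X 0,
   realized on the second factor of P \x P. *)
Lemma chain_expect n (F : M * E -> R) : bmf F ->
  \int[P]_x F (Y n x, X n x) = \int[P]_x \int[P]_y F (Y n x, X 0 y).
Proof.
move=> bF.
pose YX x := (Y n x, X n x).
have mYX : measurable_fun setT YX.
  by apply: measurable_fun_pair; [exact: measurable_chain|].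
pose YX2 (z : T * T) := (Y n z.1, X 0 z.2).
have mYX2 : measurable_fun setT YX2.
  apply: measurable_fun_pair; apply: measurableT_comp => //.
  exact: measurable_chain.
have mY A' : measurable A' -> measurable (Y n @^-1` A').
  by move=> mA'; rewrite -[X in measurable X]setTI; exact: measurable_chain.
have mX k B : measurable B -> measurable (X k @^-1` B).
  by move=> mB; rewrite -[X in measurable X]setTI; exact: measurable_funP.
pose m1 : {measure set (M * E) -> \bar R} :=
  measure_function_pushforward__canonical__measure_function_Measure P mYX.
pose m2 : {measure set (M * E) -> \bar R} :=
  measure_function_pushforward__canonical__measure_function_Measure
    (P \x P)%E mYX2.
have m12 : forall D, measurable D -> m1 D = m2 D.
  apply: eq_measure_rectangles.
    by rewrite /m1 /= /pushforward preimage_setT probability_setT ltry.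
  move=> A B mA mB; rewrite /m1 /m2 /= /pushforward.
  have -> : YX @^-1` (A `*` B) =
      Y n @^-1` A `&` future [fset n]%fset (fun=> B).
    rewrite /future set_fset1 bigcap_set1; apply/seteqP; split=> x //.
  rewrite chain_independent_future//; last by move=> k; rewrite inE => /eqP ->.
  rewrite big_seq_fset1.
  have -> : YX2 @^-1` (A `*` B) = (Y n @^-1` A) `*` (X 0 @^-1` B) by [].
  rewrite [RHS]product_measure1E//; [|exact: mY|exact: mX].
  by congr (_ * _)%E; exact: idX.
rewrite (expect_prod P P (F := fun z => F (YX2 z))); last exact: bmf_comp bF _.
rewrite /Rintegral; congr fine.
have mF : measurable_fun setT (EFin \o F) by apply/measurable_EFinP; case: bF.
have iF1 : P.-integrable (YX @^-1` setT) ((EFin \o F) \o YX).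
  rewrite preimage_setT; apply: (bmf_integrable P (f := F \o YX)).
  exact: bmf_comp bF _.
have iF2 : (P \x P)%E.-integrable (YX2 @^-1` setT) ((EFin \o F) \o YX2).
  rewrite preimage_setT.
  apply: (bmf_integrable (P \x P)%E (f := F \o YX2)).
  exact: bmf_comp bF _.
have := integral_pushforward mYX mF iF1 measurableT.
rewrite preimage_setT /= => <-.
have := integral_pushforward mYX2 mF iF2 measurableT.
rewrite preimage_setT /= => <-.
by apply: eq_measure_integral => A mA _; exact: m12.
Qed.

End driven_chain.

(** * The walk killed at its first-ladder time *)

Section killed_walk.
Context d (T : measurableType d) (R : realType) (P : probability T R).
Context dE (E : measurableType dE) (X : nat -> {RV P >-> E}).
Hypotheses (indX : mutually_independent X) (idX : identically_distributed X).
Variable g : E -> R * R.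
Hypothesis mg : measurable_fun setT g.

Definition walk n x : R * R := \sum_(k < n) g (X k x).

Definition nonpos (w : R * R) : R := (w.1 <= 0)%R%:R.

(* The indicator of the event that the first-ladder time exceeds n. *)
Definition alive n x : R := \prod_(k < n) nonpos (walk k.+1 x).

(** The law of the n-th position as a functional; [exp_alive n] is likewise the law of that position
    restricted to survival. *)
Definition exp_walk n (h : R * R -> R) := \int[P]_x h (walk n x).

Definition exp_alive n (h : R * R -> R) := \int[P]_x (alive n x * h (walk n x)).

Let walk0 x : walk 0 x = 0. Proof. by rewrite /walk big_ord0. Qed.

Let walkS n x : walk n.+1 x = walk n x + g (X n x).
Proof. by rewrite /walk big_ord_recr. Qed.

Let alive0 x : alive 0 x = 1. Proof. by rewrite /alive big_ord0. Qed.

Let aliveS n x : alive n.+1 x = alive n x * nonpos (walk n.+1 x).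
Proof. by rewrite /alive big_ord_recr. Qed.

Lemma measurable_addpair d' (Z : measurableType d') (u v : Z -> R * R) :
  measurable_fun setT u -> measurable_fun setT v ->
  measurable_fun setT (fun z => u z + v z).
Proof.
move=> mu mv; apply: measurable_fun_pair; apply: measurable_funD;
  by apply: measurableT_comp.
Qed.

Lemma nonpos_bmf : bmf nonpos.
Proof.
split; last by exists 1 => w; rewrite /nonpos normr_nat lern1 leq_b1.
rewrite (_ : nonpos = \1_[set w | w.1 <= 0]); last first.
  apply/funext => w; rewrite indicE /nonpos; congr (nat_of_bool _)%:R.
  by apply/idP/idP; rewrite inE.
apply: measurable_indic.
rewrite (_ : [set _ | _] = fst @^-1` `]-oo, 0]).
  by rewrite -[X in measurable X]setTI; exact: measurable_fst.
by apply/seteqP; split=> w /=; rewrite in_itv.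
Qed.

(** Survival becomes a component of the state, so that (walk, alive) is a chain driven by the
    increments. *)
Let step (z : (R * R) * R * E) : (R * R) * R :=
  (z.1.1 + g z.2, z.1.2 * nonpos (z.1.1 + g z.2)).

Let mstep : measurable_fun setT step.
Proof.
have m11 : measurable_fun setT (fun z : (R * R) * R * E => z.1.1).
  exact: measurableT_comp measurable_fst measurable_fst.
have mnew : measurable_fun setT (fun z : (R * R) * R * E => z.1.1 + g z.2).
  by apply: measurable_addpair => //; exact: measurableT_comp.
apply: measurable_fun_pair => //; apply: measurable_funM.
  exact: measurableT_comp measurable_snd measurable_fst.
by apply: measurableT_comp mnew; case: nonpos_bmf.
Qed.

Let chain n x := (walk n x, alive n x).

Let chain0 x : chain 0 x = (0, 1).
Proof. by rewrite /chain walk0 alive0. Qed.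

Let chainS n x : chain n.+1 x = step (chain n x, X n x).
Proof. by rewrite /chain /step /= aliveS walkS. Qed.

Let mchain n : measurable_fun setT (chain n).
Proof. exact: (measurable_chain mstep chain0 chainS). Qed.

Lemma measurable_walk n : measurable_fun setT (walk n).
Proof. exact: (measurableT_comp measurable_fst (mchain n)). Qed.

Lemma alive_bmf n : bmf (alive n).
Proof.
split; first exact: (measurableT_comp measurable_snd (mchain n)).
exists 1 => x; rewrite /alive normr_prod.
apply: prodr_ile1 => k _; rewrite normr_ge0 /= /nonpos.
by rewrite normr_nat lern1 leq_b1.
Qed.

Lemma exp_walk_bmf d' (Z : measurableType d') n (F : Z -> R * R -> R) :
  bmf (fun p : Z * (R * R) => F p.1 p.2) -> bmf (fun z => exp_walk n (F z)).
Proof.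
move=> bF; rewrite /exp_walk.
apply: (@bmf_expect _ _ _ _ _ P (fun p => F p.1 (walk n p.2))).
apply: (bmf_comp (g := fun p => (p.1, walk n p.2)) bF).
apply: measurable_fun_pair => //.
by apply: measurableT_comp => //; exact: measurable_walk.
Qed.

Lemma exp_alive_bmf d' (Z : measurableType d') n (F : Z -> R * R -> R) :
  bmf (fun p : Z * (R * R) => F p.1 p.2) -> bmf (fun z => exp_alive n (F z)).
Proof.
move=> bF; rewrite /exp_alive.
apply: (@bmf_expect _ _ _ _ _ P (fun p => alive n p.2 * F p.1 (walk n p.2))).
apply: bmfM; first by apply: bmf_comp => //; exact: alive_bmf.
apply: (bmf_comp (g := fun p => (p.1, walk n p.2)) bF).
apply: measurable_fun_pair => //.
by apply: measurableT_comp => //; exact: measurable_walk.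
Qed.

Let bmf_walk n (h : R * R -> R) : bmf h -> bmf (fun x => h (walk n x)).
Proof. by move=> bh; apply: bmf_comp => //; exact: measurable_walk. Qed.

Let bmf_aw n (h : R * R -> R) : bmf h -> bmf (fun x => alive n x * h (walk n x)).
Proof. by move=> bh; apply: bmfM; [exact: alive_bmf|exact: bmf_walk]. Qed.

Lemma exp_walk0 h : exp_walk 0 h = h 0.
Proof.
by rewrite /exp_walk -[RHS](expect_cst P); apply: eq_expect => x; rewrite walk0.
Qed.

Lemma exp_alive0 h : exp_alive 0 h = h 0.
Proof.
rewrite /exp_alive -[RHS](expect_cst P); apply: eq_expect => x.
by rewrite walk0 alive0 mul1r.
Qed.

Lemma exp_walkD n f h : bmf f -> bmf h ->
  exp_walk n (fun w => f w + h w) = exp_walk n f + exp_walk n h.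
Proof. by move=> bf bh; rewrite /exp_walk expectD//; exact: bmf_walk. Qed.

Lemma exp_walkB n f h : bmf f -> bmf h ->
  exp_walk n (fun w => f w - h w) = exp_walk n f - exp_walk n h.
Proof. by move=> bf bh; rewrite /exp_walk expectB//; exact: bmf_walk. Qed.

Lemma exp_walkZ n r h : bmf h ->
  exp_walk n (fun w => r * h w) = r * exp_walk n h.
Proof. by move=> bh; rewrite /exp_walk expectZl//; exact: bmf_walk. Qed.

Lemma exp_aliveD n f h : bmf f -> bmf h ->
  exp_alive n (fun w => f w + h w) = exp_alive n f + exp_alive n h.
Proof.
move=> bf bh; rewrite /exp_alive -expectD; [|exact: bmf_aw..].
by apply: eq_expect => x; rewrite mulrDr.
Qed.

Lemma exp_aliveB n f h : bmf f -> bmf h ->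
  exp_alive n (fun w => f w - h w) = exp_alive n f - exp_alive n h.
Proof.
move=> bf bh; rewrite /exp_alive -expectB; [|exact: bmf_aw..].
by apply: eq_expect => x; rewrite mulrBr.
Qed.

Lemma exp_aliveZ n r h : bmf h ->
  exp_alive n (fun w => r * h w) = r * exp_alive n h.
Proof.
move=> bh; rewrite /exp_alive -expectZl; last exact: bmf_aw.
by apply: eq_expect => x; rewrite mulrCA.
Qed.

Lemma eq_exp_walk n f h : f =1 h -> exp_walk n f = exp_walk n h.
Proof. by move=> fh; apply: eq_expect => x; rewrite fh. Qed.

Lemma eq_exp_alive n f h : f =1 h -> exp_alive n f = exp_alive n h.
Proof. by move=> fh; apply: eq_expect => x; rewrite fh. Qed.

Let bmf_shift d' (Z : measurableType d') (h : R * R -> R) (u v : Z -> R * R) :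
  bmf h -> measurable_fun setT u -> measurable_fun setT v ->
  bmf (fun z => h (u z + v z)).
Proof. by move=> bh mu mv; apply: bmf_comp => //; exact: measurable_addpair. Qed.

(** [exp_step] asks for a bounded function of the survival component. The identity of R is
    unbounded; the indicator of {1} agrees with it on the values 0 and 1. *)
Lemma alive_bool n x : alive n x = \1_[set 1] (alive n x).
Proof.
have [->|->] : alive n x = 1 \/ alive n x = 0.
- elim: n => [|n [] ih]; [by left; rewrite alive0| |]; last first.
    by right; rewrite aliveS ih mul0r.
  by rewrite aliveS ih mul1r /nonpos; case: (_ <= _)%R; [left|right].
- by rewrite indicE mem_set.
- by rewrite indicE memNset//= => /esym/eqP; rewrite oner_eq0.
Qed.

(** Markov property: the fresh increment is independent of the state and distributed as [walk 1].
    The factor [c] is constant for the free walk and an indicator for the killed one. *)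
Lemma exp_step (c : R -> R) n (F : R * R -> R * R -> R) : bmf c ->
  bmf (fun z : (R * R) * (R * R) => F z.1 z.2) ->
  \int[P]_x (c (alive n x) * F (walk n x) (g (X n x))) =
  \int[P]_x (c (alive n x) * exp_walk 1 (F (walk n x))).
Proof.
move=> bc bF.
transitivity (\int[P]_x \int[P]_y
    (c (alive n x) * F (walk n x) (g (X 0 y)))).
  apply: (chain_expect indX idX mstep chain0 chainS n
    (F := fun z => c z.1.2 * F z.1.1 (g z.2))).
  apply: bmfM.
    apply: (bmf_comp (g := fun z => z.1.2) bc).
    exact: measurableT_comp measurable_snd measurable_fst.
  apply: (bmf_comp (g := fun z => (z.1.1, g z.2)) bF).
  apply: measurable_fun_pair; last exact: measurableT_comp.
  exact: measurableT_comp measurable_fst measurable_fst.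
apply: eq_expect => x; rewrite /exp_walk -expectZl.
  by apply: eq_expect => y; rewrite /walk big_ord1.
apply: bmf_walk; apply: (bmf_comp (g := fun v => (walk n x, v)) bF).
exact: measurable_fun_pair.
Qed.

Lemma exp_walkS n h : bmf h ->
  exp_walk n.+1 h = exp_walk n (fun w => exp_walk 1 (fun v => h (w + v))).
Proof.
move=> bh; transitivity (\int[P]_x (1 * h (walk n x + g (X n x)))).
  by apply: eq_expect => x; rewrite mul1r walkS.
rewrite (@exp_step (fun=> 1) n (fun w v => h (w + v)) (bmf_cst _ 1)).
  by apply: eq_expect => x; rewrite mul1r.
exact: bmf_shift.
Qed.

(** Survival is tested at n, the position read at n+1. With [nonpos] put into the test function this
    gives [exp_aliveS]; without it, [alive_char_next]. *)
Lemma exp_alive_next n h : bmf h ->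
  \int[P]_x (alive n x * h (walk n.+1 x)) =
  exp_alive n (fun w => exp_walk 1 (fun v => h (w + v))).
Proof.
move=> bh; rewrite /exp_alive.
under eq_expect do rewrite walkS alive_bool.
under [RHS]eq_expect do rewrite alive_bool.
apply: (@exp_step (\1_[set 1]) n (fun w v => h (w + v))).
  split; first exact: measurable_indic.
  by exists 1 => x; rewrite indicE normr_nat lern1 leq_b1.
by apply: bmf_shift.
Qed.

Lemma exp_aliveS n h : bmf h ->
  exp_alive n.+1 h =
  exp_alive n (fun w => exp_walk 1 (fun v => nonpos (w + v) * h (w + v))).
Proof.
move=> bh; rewrite -(@exp_alive_next n (fun w => nonpos w * h w)).
  by apply: eq_expect => x; rewrite aliveS mulrA.
by apply: bmfM => //; exact: nonpos_bmf.
Qed.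

(** Commutativity of the convolution with the law of an increment, by Fubini. *)
Lemma exp_aliveC n (F : R * R -> R * R -> R) :
  bmf (fun p : (R * R) * (R * R) => F p.1 p.2) ->
  exp_alive n (fun w => exp_walk 1 (F w)) =
  exp_walk 1 (fun v => exp_alive n (fun w => F w v)).
Proof.
move=> bF; rewrite /exp_alive /exp_walk.
transitivity (\int[P]_x \int[P]_y (alive n x * F (walk n x) (walk 1 y))).
  apply: eq_expect => x; rewrite expectZl//; apply: bmf_walk.
  apply: (bmf_comp (g := fun v => (walk n x, v)) bF).
  exact: measurable_fun_pair.
apply: (expectC P P (F := fun p => alive n p.1 * F (walk n p.1) (walk 1 p.2))).
apply: bmfM; first by apply: bmf_comp => //; exact: alive_bmf.
apply: (bmf_comp (g := fun p => (walk n p.1, walk 1 p.2)) bF).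
by apply: measurable_fun_pair; apply: measurableT_comp => //;
  exact: measurable_walk.
Qed.

(* This makes the restriction of measures to a half-plane a Rota-Baxter
   operator. *)
Lemma nonpos_rota_baxter u v : nonpos u * nonpos v =
  nonpos (u + v) * nonpos v + nonpos u * nonpos (u + v) - nonpos (u + v).
Proof.
rewrite /nonpos /=.
have [u0|u0] := leP u.1 0; have [v0|v0] := leP v.1 0;
  have [uv|uv] := leP (u.1 + v.1) 0; rewrite /=; try lra.
Qed.

Local Ltac bm := repeat (cbv beta; lazymatch goal with
  | H : bmf ?h |- bmf ?h => exact: H
  | H : bmf ?h |- bmf (fun z => ?h (_ + _)) => apply: (bmf_shift H)
  | H : bmf ?h |- bmf (fun z => ?h _) => apply: (bmf_comp H)
  | |- bmf nonpos => exact: nonpos_bmf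
  | |- bmf (fun z => nonpos (_ + _)) => apply: (bmf_shift nonpos_bmf)
  | |- bmf (fun z => nonpos _) => apply: (bmf_comp nonpos_bmf)
  | |- bmf (fun z => exp_alive _ _) => apply: exp_alive_bmf
  | |- bmf (fun z => exp_walk _ _) => apply: exp_walk_bmf
  | |- bmf (fun z => _ * _) => apply: bmfM
  | |- bmf (fun z => _ - _) => apply: bmfB
  | |- bmf (fun z => _ + _) => apply: bmfD
  | |- bmf (fun z => _) => exact: bmf_cst
  | |- measurable_fun _ (+%R ?u) => change (measurable_fun setT (fun z => u + z))
  | |- measurable_fun _ (fun z => _ + _) => apply: measurable_addpair
  | |- measurable_fun _ (fun z => fst (fst z)) =>
      exact: (measurableT_comp measurable_fst measurable_fst)
  | |- measurable_fun _ (fun z => snd (fst z)) =>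
      exact: (measurableT_comp measurable_snd measurable_fst)
  | |- measurable_fun _ (fun z => fst z) => exact: measurable_fst
  | |- measurable_fun _ (fun z => snd z) => exact: measurable_snd
  | |- measurable_fun _ (fun z => z) => exact: measurable_id
  | |- measurable_fun _ (fun z => _) => exact: measurable_cst
  end).

(* In the commutative algebra of finite measures on R * R under convolution, let
   pi be the restriction to the lower half-plane, f the law of one increment and
   b_n = pi (f * b_(n-1)): this is n b_n = \sum_(1 <= k <= n) pi (f^k) * b_(n-k).
   The sums D k - D k.+1 below telescope. *)
Lemma spitzer_recursion n h : bmf h ->
  n%:R * exp_alive n h =
  \sum_(k < n) exp_walk k.+1 (fun w =>
     nonpos w * exp_alive (n - k.+1) (fun v => h (w + v))).
Proof.
elim: n h => [|n ih] h bh; first by rewrite mul0r big_ord0.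
have [Ph PhE] : {Ph | forall v, Ph v = nonpos v * h v}.
  by exists (fun v => nonpos v * h v).
have bPh : bmf Ph by rewrite (_ : Ph = (fun v => nonpos v * h v)); [bm|exact/funext].
(* [D k] is pi (f^k * b_(n+1-k)) tested on [h]. *)
pose D k := exp_walk k (fun w => exp_alive (n.+1 - k) (fun v => Ph (w + v))).
(* Testing nu on [h'] is testing pi (f * nu) on [h]; thus b_n on [h'] is b_(n+1) on [h], and the
   induction hypothesis is applied to [h']. *)
have [h' h'E] : {h' | forall w, h' w = exp_walk 1 (fun v => Ph (w + v))}.
  by exists (fun w => exp_walk 1 (fun v => Ph (w + v))).
have bh' : bmf h'.
  by rewrite (_ : h' = (fun w => exp_walk 1 (fun v => Ph (w + v)))); [bm|exact/funext].
have aliveE m w : exp_alive m.+1 (fun v => Ph (w + v)) =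
    exp_alive m (fun v => exp_walk 1 (fun u => nonpos (v + u) * Ph (w + (v + u)))).
  by rewrite exp_aliveS//; bm.
(* Rota-Baxter for f^(k+1) and f * b_m, with m = n - k - 1 and pi (f * b_m) = b_(m+1): its three
   terms are [D k.+1], the k-th summand of the recursion for [h'], and [D k.+2]. *)
have term k : (k < n)%N ->
    exp_walk k.+1 (fun w => nonpos w * exp_alive (n - k) (fun v => h (w + v)))
    = D k.+1 - D k.+2 + exp_walk k.+1 (fun w =>
        nonpos w * exp_alive (n - k.+1) (fun v => h' (w + v))).
  move=> kn; rewrite /D !subSS; have -> : (n - k = (n - k.+1).+1)%N by lia.
  move: (n - k.+1)%N => m.
  rewrite [exp_walk k.+2 _]exp_walkS; last by bm.
  transitivity (exp_walk k.+1 (fun w => exp_alive m.+1 (fun v => Ph (w + v)) -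
      exp_walk 1 (fun v => exp_alive m (fun u => Ph (w + v + u))) +
      nonpos w * exp_alive m (fun v => h' (w + v)))); last first.
    by rewrite exp_walkD ?exp_walkB//; bm.
  apply: eq_exp_walk => w.
  rewrite aliveE exp_aliveS; last by bm.
  rewrite -(@exp_aliveC m (fun u v => Ph (w + v + u))); last by bm.
  rewrite -!exp_aliveZ; [|by bm..].
  rewrite -exp_aliveB; [|by bm..].
  rewrite -exp_aliveD; [|by bm..].
  apply: eq_exp_alive => v; rewrite h'E.
  rewrite -!exp_walkZ; [|by bm..].
  rewrite -exp_walkB; [|by bm..].
  rewrite -exp_walkD; [|by bm..].
  apply: eq_exp_walk => u; rewrite -!addrA (addrC u v) !PhE.
  by rewrite mulrA nonpos_rota_baxter; ring.
rewrite big_ord_recr /= subnn.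
under eq_bigr => k _ do rewrite subSS term//.
rewrite big_split /= -ih//.
have D1 : D 1%N = exp_alive n.+1 h.
  rewrite /D subSS subn0 exp_aliveS// -(@exp_aliveC n (fun v w => Ph (w + v))).
    apply: eq_exp_alive => w; apply: eq_exp_walk => v.
    by rewrite addrC PhE.
  by bm.
have alive_h' : exp_alive n h' = exp_alive n.+1 h.
  rewrite exp_aliveS//; apply: eq_exp_alive => w; rewrite h'E.
  by apply: eq_exp_walk => v; rewrite PhE.
(* The summand k = n escapes [term], since b_0 is the unit mass at 0 and no restricted convolution;
   it cancels the last term of the telescoping sum. *)
have DS : exp_walk n.+1 (fun w => nonpos w * exp_alive 0 (fun v => h (w + v)))
    = D n.+1.
  rewrite /D subnn; apply: eq_exp_walk => w.
  by rewrite !exp_alive0 addr0 PhE.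
have -> : \sum_(k < n) (D k.+1 - D k.+2) = D 1%N - D n.+1.
  rewrite -(big_mkord xpredT (fun k => D k.+1 - D k.+2)).
  under eq_bigr do rewrite -opprB.
  by rewrite sumrN telescope_sumr// opprB.
by rewrite DS D1 alive_h' -natr1; ring.
Qed.

(** * Characters: convolutions become products *)

Let cos2 (w : R * R) := cos w.2.
Let sin2 (w : R * R) := sin w.2.

Let bmf_cos2 : bmf cos2.
Proof.
split; last by exists 1 => w; rewrite ler_norml cos_geN1 cos_le1.
apply: measurableT_comp => //.
by apply: continuous_measurable_fun; exact: continuous_cos.
Qed.

Let bmf_sin2 : bmf sin2.
Proof.
split; last by exists 1 => w; rewrite ler_norml sin_geN1 sin_le1.
apply: measurableT_comp => //.
by apply: continuous_measurable_fun; exact: continuous_sin.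
Qed.

Definition walk_char n : R[i] := exp_walk n cos2 +i* exp_walk n sin2.

Definition alive_char n : R[i] := exp_alive n cos2 +i* exp_alive n sin2.

Definition nonpos_char n : R[i] :=
  exp_walk n (fun w => nonpos w * cos2 w) +i*
  exp_walk n (fun w => nonpos w * sin2 w).

Let exp_walk_cosD n w : exp_walk n (fun v => cos2 (w + v)) =
  cos2 w * exp_walk n cos2 - sin2 w * exp_walk n sin2.
Proof.
rewrite -!exp_walkZ// -exp_walkB; [|by bm..].
by apply: eq_exp_walk => v; rewrite /cos2 cosD.
Qed.

Let exp_walk_sinD n w : exp_walk n (fun v => sin2 (w + v)) =
  sin2 w * exp_walk n cos2 + cos2 w * exp_walk n sin2.
Proof.
rewrite -!exp_walkZ// -exp_walkD; [|by bm..].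
by apply: eq_exp_walk => v; rewrite /sin2 sinD.
Qed.

Let exp_alive_cosD n w : exp_alive n (fun v => cos2 (w + v)) =
  cos2 w * exp_alive n cos2 - sin2 w * exp_alive n sin2.
Proof.
rewrite -!exp_aliveZ// -exp_aliveB; [|by bm..].
by apply: eq_exp_alive => v; rewrite /cos2 cosD.
Qed.

Let exp_alive_sinD n w : exp_alive n (fun v => sin2 (w + v)) =
  sin2 w * exp_alive n cos2 + cos2 w * exp_alive n sin2.
Proof.
rewrite -!exp_aliveZ// -exp_aliveD; [|by bm..].
by apply: eq_exp_alive => v; rewrite /sin2 sinD.
Qed.

Lemma alive_char0 : alive_char 0 = 1.
Proof. by rewrite /alive_char !exp_alive0 /cos2 /sin2 /= cos0 sin0. Qed.

(** The phase is additive, so the addition formulas for cos and sin turn [spitzer_recursion], tested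
    on them, into a product of complex numbers. *)
Lemma alive_char_recursion n : n.+1%:R * alive_char n.+1 =
  \sum_(k < n.+1) nonpos_char k.+1 * alive_char (n - k).
Proof.
apply: complex_eq; rewrite complex_natr ?Re_scale ?Im_scale ?Re_sum ?Im_sum /=.
  rewrite spitzer_recursion//; apply: eq_bigr => k _.
  rewrite subSS ?ReM /= mulrC (mulrC (exp_walk _ (fun w => _ * sin2 w))).
  rewrite -!exp_walkZ; [|by bm..]; rewrite -exp_walkB; [|by bm..].
  by apply: eq_exp_walk => w; rewrite exp_alive_cosD; ring.
rewrite spitzer_recursion//; apply: eq_bigr => k _.
rewrite subSS ?ImM /= mulrC (mulrC (exp_walk _ (fun w => _ * sin2 w))).
rewrite -!exp_walkZ; [|by bm..]; rewrite -exp_walkD; [|by bm..].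
by apply: eq_exp_walk => w; rewrite exp_alive_sinD; ring.
Qed.

Lemma walk_charX n : walk_char n = walk_char 1 ^+ n.
Proof.
elim: n => [|n ih].
  by rewrite expr0 /walk_char !exp_walk0 /cos2 /sin2 /= cos0 sin0.
rewrite exprS -ih; apply: complex_eq; rewrite ?ReM ?ImM /=.
  rewrite exp_walkS// -!exp_walkZ// -exp_walkB; [|by bm..].
  by apply: eq_exp_walk => w; rewrite exp_walk_cosD; ring.
rewrite exp_walkS// -!exp_walkZ// -exp_walkD; [|by bm..].
by apply: eq_exp_walk => w; rewrite exp_walk_sinD; ring.
Qed.

(** Each summand is phi^(n+1). The shape is that of [alive_char_recursion], so the same differential
    equation gives the exponential formula for the geometric series of z phi. *)
Lemma walk_char_recursion n : n.+1%:R * walk_char n.+1 =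
  \sum_(k < n.+1) walk_char k.+1 * walk_char (n - k).
Proof.
transitivity (\sum_(k < n.+1) walk_char n.+1).
  by rewrite sumr_const card_ord mulr_natl.
apply: eq_bigr => k _.
rewrite (walk_charX n.+1) (walk_charX k.+1) (walk_charX (n - k)) -exprD.
congr (_ ^+ _).
by have := ltn_ord k; lia.
Qed.

(** The right side lives on T > n with the position at n+1; subtracting [alive_char n.+1] leaves the
    event T = n+1. *)
Lemma alive_char_next n : alive_char n * walk_char 1 =
  \int[P]_x (alive n x * cos (walk n.+1 x).2) +i*
  \int[P]_x (alive n x * sin (walk n.+1 x).2).
Proof.
rewrite (exp_alive_next n bmf_cos2) (exp_alive_next n bmf_sin2).
apply: complex_eq; rewrite ?ReM ?ImM /=.
  rewrite mulrC (mulrC (exp_alive n sin2)) -!exp_aliveZ// -exp_aliveB; [|by bm..].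
  by apply: eq_exp_alive => w; rewrite exp_walk_cosD; ring.
rewrite mulrC (mulrC (exp_alive n sin2)) -!exp_aliveZ// -exp_aliveD; [|by bm..].
by apply: eq_exp_alive => w; rewrite exp_walk_sinD; ring.
Qed.

Lemma alive_itv n x : 0 <= alive n x <= 1.
Proof.
apply/andP; split; first by apply: prodr_ge0 => k _; rewrite ler0n.
by apply: prodr_ile1 => k _; rewrite ler0n lern1 leq_b1.
Qed.

Let exp_walk_le n h : bmf h -> (forall w, `|h w| <= 1) -> `|exp_walk n h| <= 1.
Proof. by move=> bh h1; apply: expect_norm_le => //; exact: bmf_walk. Qed.

Let exp_alive_le n h : bmf h -> (forall w, `|h w| <= 1) -> `|exp_alive n h| <= 1.
Proof.
move=> bh h1; apply: expect_norm_le => [|x]; first exact: bmf_aw.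
have /andP[a0 a1] := alive_itv n x.
by rewrite normrM mulr_ile1// ger0_norm.
Qed.

Let cos2_le w : `|cos2 w| <= 1.
Proof. by rewrite ler_norml cos_geN1 cos_le1. Qed.

Let sin2_le w : `|sin2 w| <= 1.
Proof. by rewrite ler_norml sin_geN1 sin_le1. Qed.

Let nonpos_le (f : R * R -> R) : (forall w, `|f w| <= 1) ->
  forall w, `|nonpos w * f w| <= 1.
Proof.
by move=> f1 w; rewrite normrM mulr_ile1// /nonpos normr_nat lern1 leq_b1.
Qed.

Lemma walk_char_le n :
  `|complex.Re (walk_char n)| <= 1 /\ `|complex.Im (walk_char n)| <= 1.
Proof. by split; apply: exp_walk_le. Qed.

Lemma alive_char_le n :
  `|complex.Re (alive_char n)| <= 1 /\ `|complex.Im (alive_char n)| <= 1.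
Proof. by split; apply: exp_alive_le. Qed.

Lemma nonpos_char_le n :
  `|complex.Re (nonpos_char n)| <= 1 /\ `|complex.Im (nonpos_char n)| <= 1.
Proof. by split; apply: exp_walk_le => //; [bm|exact: nonpos_le|bm|exact: nonpos_le]. Qed.

Lemma cos_walk_bmf n : bmf (fun x => cos (walk n x).2).
Proof. exact: bmf_walk bmf_cos2. Qed.

Lemma sin_walk_bmf n : bmf (fun x => sin (walk n x).2).
Proof. exact: bmf_walk bmf_sin2. Qed.

Lemma nonpos_walk_bmf n : bmf (fun x => nonpos (walk n x)).
Proof. exact: bmf_walk nonpos_bmf. Qed.

End killed_walk.

(** * Power series solutions of u' = q u *)

(** With w the fourth root of z, n^2 z^n = (n w^n)^2 (w^2)^n: a bounded factor times a geometric
    one. *)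
Lemma cvg_sqr_expr (R : realType) (z : R) : 0 <= z -> z < 1 ->
  (fun n => n%:R ^+ 2 * z ^+ n) @ \oo --> 0.
Proof.
move=> z0 z1; pose w := Num.sqrt (Num.sqrt z).
have w0 : 0 <= w by exact: sqrtr_ge0.
have w4 : w ^+ 4 = z by rewrite (exprM w 2 2) /w !sqr_sqrtr// sqrtr_ge0.
have w1 : w < 1 by rewrite -(@expr_lt1 _ 4)// w4.
have nw n : n%:R * w ^+ n <= (1 - w)^-1.
  rewrite -[leRHS]div1r ler_pdivlMr ?subr_gt0//.
  suff : n%:R * w ^+ n * (1 - w) <= 1 - w ^+ n.
    by move=> /le_trans; apply; rewrite gerBl exprn_ge0.
  elim: n => [|n ih]; first by rewrite !mul0r expr0 subrr.
  have wn1 : w ^+ n <= 1 by rewrite exprn_ile1// ltW.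
  have wn0 : 0 <= w ^+ n by rewrite exprn_ge0.
  have h1 := ler_wpM2l w0 ih.
  have h2 : 0 <= (1 - w) * (1 - w * w ^+ n).
    by rewrite mulr_ge0 ?subr_ge0 ?mulr_ile1// ltW.
  by rewrite -natr1 exprS; lra.
apply: (@squeeze_cvgr _ _ _ _ (cst 0) (fun n => (1 - w)^-1 ^+ 2 * (w ^+ 2) ^+ n)).
- near=> n; rewrite mulr_ge0 ?sqr_ge0 ?exprn_ge0//=.
  rewrite -w4 (_ : _ * _ = (n%:R * w ^+ n) ^+ 2 * (w ^+ 2) ^+ n).
    rewrite ler_wpM2r ?exprn_ge0// lerXn2r// ?nnegrE ?mulr_ge0 ?exprn_ge0//.
    by rewrite invr_ge0 subr_ge0 ltW.
  by rewrite (exprMn 2 n%:R) -!exprM -[RHS]mulrA -exprD; congr (_ * _ ^+ _); lia.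
- exact: cvg_cst.
- apply: (@cvg_geometric R).
  by rewrite ger0_norm ?exprn_ge0// expr_lt1.
Unshelve. all: by end_near. Qed.

Lemma bounded_coef_cvg (R : realType) (a : nat -> R) (z : R) : 0 <= z ->
  z < 1 -> (forall n, `|a n| <= 1) ->
  cvgn (fun n => \sum_(k < n) a k * z ^+ k).
Proof.
move=> z0 z1 a1.
rewrite (_ : (fun _ => _) = series (fun k => a k * z ^+ k)); last first.
  by apply/funext => n; rewrite /series /= big_mkord.
apply: normed_cvg; apply: (@series_le_cvg _ _ (geometric 1 z)) => //=.
- by move=> n; rewrite mul1r exprn_ge0.
- move=> n; rewrite mul1r normrM (ger0_norm (exprn_ge0 _ _))//.
  by rewrite ler_piMl// exprn_ge0.
- by apply: is_cvg_geometric_series; rewrite ger0_norm.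
Qed.

Lemma bounded_coef_le (R : realType) (a : nat -> R) (z : R) n : 0 <= z ->
  z < 1 -> (forall n, `|a n| <= 1) ->
  `|\sum_(k < n) a k * z ^+ k| <= (1 - z)^-1.
Proof.
move=> z0 z1 a1; apply: le_trans (ler_norm_sum _ _ _) _.
apply: (@le_trans _ _ (\sum_(k < n) z ^+ k)).
  apply: ler_sum => k _; rewrite normrM (ger0_norm (exprn_ge0 _ _))//.
  by rewrite ler_piMl// exprn_ge0.
rewrite -[leRHS]div1r ler_pdivlMr ?subr_gt0// mulrC.
have -> : (1 - z) * \sum_(k < n) z ^+ k = 1 - z ^+ n.
  by rewrite -opprB mulNr -subrX1 opprB.
by rewrite gerBl exprn_ge0.
Qed.

(** Componentwise, so that real limit theorems apply; [ccvg_limn] is the bridge to the norm topology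
    of [cseries_sum]. *)
Definition ccvg (R : realType) (s : nat -> R[i]) (l : R[i]) :=
  ((fun n => complex.Re (s n)) @ \oo --> complex.Re l) /\
  ((fun n => complex.Im (s n)) @ \oo --> complex.Im l).

Section exponential_ode.
Variable R : realType.
Implicit Types a b c d : {poly R}.

(* The real part of (a + i b) exp (- (c + i d)). *)
Let G a b c d (x : R) := expR (- c.[x]) * (a.[x] * cos d.[x] + b.[x] * sin d.[x]).

(** The two polynomials bounded by [eta] are the real and imaginary parts of (a + i b)' - (c + i d)'
    (a + i b), the factor of exp (- (c + i d)) in the derivative; the mean value theorem does the
    rest. *)
Lemma ode_defect_bound a b c d (z K eta : R) : 0 <= z ->
  (forall x, 0 <= x <= z ->
    [/\ `|c.[x]| <= K, `|(a^`() - c^`() * a + d^`() * b).[x]| <= eta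
      & `|(b^`() - c^`() * b - d^`() * a).[x]| <= eta]) ->
  `|G a b c d z - G a b c d 0| <= expR K * (eta + eta) * z.
Proof.
move=> z0 bnd.
pose G' x := expR (- c.[x]) *
  ((a^`() - c^`() * a + d^`() * b).[x] * cos d.[x] +
   (b^`() - c^`() * b - d^`() * a).[x] * sin d.[x]).
have dG (x : R) : is_derive x (1 : R) (G a b c d : R -> R) (G' x).
  have dcos := is_derive1_comp (is_derive_cos d.[x]) (is_derive_poly d x).
  have dsin := is_derive1_comp (is_derive_sin d.[x]) (is_derive_poly d x).
  have dN := is_deriveN (is_derive_poly c x).
  have dexp := is_derive1_comp (is_derive_expR ((- horner c) x)) dN.
  have dprod := is_deriveM dexp (is_deriveD (is_deriveM (is_derive_poly a x) dcos)
     (is_deriveM (is_derive_poly b x) dsin)).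
  apply: (is_derive_eq dprod).
  rewrite /G' !hornerE /GRing.scale /=.
  rewrite -[(- horner c) x]/(- c.[x]).
  rewrite -[(horner a * _ + horner b * _) x]/
    (a.[x] * cos d.[x] + b.[x] * sin d.[x]).
  by ring.
have cG : continuous (G a b c d).
  by move=> x; apply/differentiable_continuous/derivable1_diffP; case: (dG x).
have [x] := @MVT_segment R (G a b c d) G' 0 z z0 (fun x _ => dG x)
  (continuous_subspaceT cG).
rewrite in_itv /= subr0 => /bnd[cK e1 e2] ->.
rewrite normrM (ger0_norm z0) ler_wpM2r// /G' normrM.
rewrite (ger0_norm (expR_ge0 _)) ler_pM ?expR_ge0//.
  rewrite ler_expR (le_trans _ cK)// -normrN ler_norm//.
rewrite (le_trans (ler_normD _ _))// lerD// normrM.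
  rewrite -[leRHS]mulr1 ler_pM// ler_norml cos_geN1 cos_le1//.
by rewrite -[leRHS]mulr1 ler_pM// ler_norml sin_geN1 sin_le1.
Qed.

Variables u q : nat -> R[i].
Hypotheses (u0 : u 0 = 1)
  (uS : forall n, n.+1%:R * u n.+1 = \sum_(k < n.+1) q k * u (n - k)%N)
  (Re_u : forall n, `|complex.Re (u n)| <= 1)
  (Im_u : forall n, `|complex.Im (u n)| <= 1)
  (Re_q : forall n, `|complex.Re (q n)| <= 1)
  (Im_q : forall n, `|complex.Im (q n)| <= 1).
Variable z : R.
Hypotheses (z_gt0 : 0 < z) (z1 : z < 1).

Let z0 : 0 <= z := ltW z_gt0.

Let a N := \poly_(n < N.+1) complex.Re (u n).
Let b N := \poly_(n < N.+1) complex.Im (u n).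
Let c N := \poly_(n < N.+1) (complex.Re (q n.-1) / n%:R).
Let d N := \poly_(n < N.+1) (complex.Im (q n.-1) / n%:R).

(* As q is indexed from 0, the coefficient of x ^ n in c + i d is q (n - 1) / n;
   it vanishes for n = 0 because x / 0 = 0. *)
Let coef_dc N i : (c N)^`()`_i = if (i < N)%N then complex.Re (q i) else 0.
Proof.
rewrite coef_deriv coef_poly ltnS; case: ifP => _; last by rewrite mul0rn.
by rewrite /= -[LHS]mulr_natr divfK// pnatr_eq0.
Qed.

Let coef_dd N i : (d N)^`()`_i = if (i < N)%N then complex.Im (q i) else 0.
Proof.
rewrite coef_deriv coef_poly ltnS; case: ifP => _; last by rewrite mul0rn.
by rewrite /= -[LHS]mulr_natr divfK// pnatr_eq0.
Qed.

(** Below degree N the truncation is invisible, and the coefficient is the real part of [uS]. *)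
Let defect_Re N i : (i < N)%N ->
  ((a N)^`() - (c N)^`() * a N + (d N)^`() * b N)`_i = 0.
Proof.
move=> iN; rewrite !coefD coefN !coefM coef_deriv coef_poly ltnS iN -mulr_natl.
have := congr1 (@complex.Re R) (uS i).
rewrite complex_natr Re_scale Re_sum => ->.
rewrite -sumrN -big_split -big_split /= big1// => k _.
have ki : (k <= i)%N by rewrite -ltnS.
have ik : (i - k < N.+1)%N by lia.
rewrite coef_dc coef_dd !coef_poly (leq_ltn_trans ki iN).
by rewrite ik ReM; ring.
Qed.

Let defect_Im N i : (i < N)%N ->
  ((b N)^`() - (c N)^`() * b N - (d N)^`() * a N)`_i = 0.
Proof.
move=> iN; rewrite !coefD !coefN !coefM coef_deriv coef_poly ltnS iN -mulr_natl.
have := congr1 (@complex.Im R) (uS i).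
rewrite complex_natr Im_scale Im_sum => ->.
rewrite -!sumrN -big_split -big_split /= big1// => k _.
have ki : (k <= i)%N by rewrite -ltnS.
have ik : (i - k < N.+1)%N by lia.
rewrite coef_dc coef_dd !coef_poly (leq_ltn_trans ki iN).
by rewrite ik ImM; ring.
Qed.

Let prod_coef_le (p1 p2 : {poly R}) i : (forall k, `|p1`_k| <= 1) ->
  (forall k, `|p2`_k| <= 1) -> `|(p1 * p2)`_i| <= i.+1%:R.
Proof.
move=> h1 h2; rewrite coefM (le_trans (ler_norm_sum _ _ _))//.
rewrite (le_trans (y := \sum_(k < i.+1) 1))//.
  by apply: ler_sum => k _; rewrite normrM mulr_ile1.
by rewrite sumr_const card_ord.
Qed.

(** At most 2N+1 terms, each at most 2(2N+1) z^N, and 2(2N+1)^2 is below 16(N+1)^2. *)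
Let truncated_horner_le (p : {poly R}) N x : 0 <= x <= z ->
  (forall i, (i < N)%N -> p`_i = 0) -> (size p <= N.*2.+1)%N ->
  (forall i, (N <= i)%N -> `|p`_i| <= i.+1.*2%:R) ->
  `|p.[x]| <= (16 * N.+1%:R ^+ 2) * z ^+ N.
Proof.
move=> /andP[x0 xz] p0 sp pb; rewrite (horner_coef_wide _ sp).
rewrite (le_trans (ler_norm_sum _ _ _))//.
rewrite (le_trans (y := \sum_(i < N.*2.+1) (N.*2.+1.*2%:R * z ^+ N)))//.
  apply: ler_sum => i _; have [iN|Ni] := ltnP i N.
    by rewrite p0// mul0r normr0 mulr_ge0 ?exprn_ge0.
  rewrite normrM ler_pM// ?(le_trans (pb _ Ni))//.
    by rewrite ler_nat leq_double.
  rewrite ger0_norm ?exprn_ge0// (le_trans (y := z ^+ i))//.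
    by rewrite lerXn2r// nnegrE.
  by rewrite ler_wiXn2l// ltW.
rewrite sumr_const card_ord -[leLHS]mulr_natl mulrA ler_wpM2r ?exprn_ge0//.
rewrite -natrM -natrX -natrM ler_nat; nia.
Qed.

Let div_le1 (r : R) n : `|r| <= 1 -> `|r / n%:R| <= 1.
Proof.
move=> r1; case: n => [|n]; first by rewrite invr0 mulr0 normr0.
rewrite normrM normfV normr_nat ler_pdivrMr// mul1r (le_trans r1)//.
by rewrite ler1n.
Qed.

Let c_le N x : 0 <= x <= z -> `|(c N).[x]| <= (1 - z)^-1.
Proof.
move=> /andP[x0 xz]; have x1 := le_lt_trans xz z1.
rewrite horner_poly; apply: le_trans
  (@bounded_coef_le _ (fun n => complex.Re (q n.-1) / n%:R) _ _ x0 x1 _) _.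
  by move=> k; exact: div_le1.
by rewrite lef_pV2 ?posrE ?subr_gt0// lerD2l lerN2.
Qed.

(** One form for both defects, signs being absorbed in the factors. From degree N on the derivative
    has no coefficients, and each product contributes at most i+1. *)
Let defect_le (p1 p2 p3 p4 p5 : {poly R}) N x : 0 <= x <= z ->
  (forall i, (i < N)%N -> (p1^`() + p2 * p3 + p4 * p5)`_i = 0) ->
  (size p1 <= N.+1)%N ->
  (size p2 <= N)%N -> (size p3 <= N.+1)%N ->
  (size p4 <= N)%N -> (size p5 <= N.+1)%N ->
  (forall k, `|p2`_k| <= 1) -> (forall k, `|p3`_k| <= 1) ->
  (forall k, `|p4`_k| <= 1) -> (forall k, `|p5`_k| <= 1) ->
  `|(p1^`() + p2 * p3 + p4 * p5).[x]| <= (16 * N.+1%:R ^+ 2) * z ^+ N.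
Proof.
move=> xz defect0 s1 s2 s3 s4 s5 b2 b3 b4 b5.
apply: truncated_horner_le => //.
  have sM (r1 r2 : {poly R}) : (size r1 <= N)%N -> (size r2 <= N.+1)%N ->
      (size (r1 * r2)%R <= N.*2.+1)%N.
    by move=> ? ?; rewrite (leq_trans (size_polyMleq _ _))//; lia.
  apply: leq_trans (size_polyD _ _) _; rewrite geq_max sM// andbT.
  apply: leq_trans (size_polyD _ _) _; rewrite geq_max sM// andbT.
  by apply/leq_sizeP => j Nj; rewrite coef_deriv nth_default ?mul0rn//;
    apply: (leq_trans s1); lia.
move=> i Ni; rewrite !coefD.
have -> : p1^`()`_i = 0 by rewrite coef_deriv nth_default ?mul0rn//;
    apply: (leq_trans s1); lia.
rewrite add0r (le_trans (ler_normD _ _))// -addnn natrD.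
by rewrite lerD// prod_coef_le.
Qed.

Let defect_bound N := expR (1 - z)^-1 *
  ((16 * N.+1%:R ^+ 2) * z ^+ N + (16 * N.+1%:R ^+ 2) * z ^+ N) * z.

Let defect_bound_cvg : defect_bound @ \oo --> 0.
Proof.
have h := cvg_sqr_expr z0 z1; rewrite -(cvg_shiftS _) /= in h.
(* 32 is 16 + 16, and the last factor z turns z^N into z^(N+1), matching the shifted limit. *)
rewrite -[X in _ --> X](mulr0 (expR (1 - z)^-1 * 32)).
rewrite (_ : defect_bound =
  (fun N => expR (1 - z)^-1 * 32 * (N.+1%:R ^+ 2 * z ^+ N.+1))).
  by apply: cvgM => //; exact: cvg_cst.
by apply/funext => N; rewrite /defect_bound (exprS z); ring.
Qed.

Let coef_a_le N k : `|(a N)`_k| <= 1.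
Proof. by rewrite coef_poly; case: ifP; rewrite ?normr0. Qed.

Let coef_b_le N k : `|(b N)`_k| <= 1.
Proof. by rewrite coef_poly; case: ifP; rewrite ?normr0. Qed.

Let coef_dc_le N k : `|(c N)^`()`_k| <= 1.
Proof. by rewrite coef_dc; case: ifP; rewrite ?normr0. Qed.

Let coef_dd_le N k : `|(d N)^`()`_k| <= 1.
Proof. by rewrite coef_dd; case: ifP; rewrite ?normr0. Qed.

Let size_dc N : (size (c N)^`() <= N)%N.
Proof. by apply/leq_sizeP => j Nj; rewrite coef_dc ltnNge Nj. Qed.

Let size_dd N : (size (d N)^`() <= N)%N.
Proof. by apply/leq_sizeP => j Nj; rewrite coef_dd ltnNge Nj. Qed.

Let Re_defect_le N x : 0 <= x <= z ->
  `|((a N)^`() - (c N)^`() * a N + (d N)^`() * b N).[x]| <=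
  (16 * N.+1%:R ^+ 2) * z ^+ N.
Proof.
move=> xz; rewrite -mulNr; apply: defect_le => //; rewrite ?size_poly ?size_polyN//.
  by move=> i iN; rewrite mulNr defect_Re.
by move=> k; rewrite coefN normrN.
Qed.

Let Im_defect_le N x : 0 <= x <= z ->
  `|((b N)^`() - (c N)^`() * b N - (d N)^`() * a N).[x]| <=
  (16 * N.+1%:R ^+ 2) * z ^+ N.
Proof.
move=> xz; rewrite -!mulNr; apply: defect_le => //;
  rewrite ?size_poly ?size_polyN//.
- by move=> i iN; rewrite !mulNr defect_Im.
- by move=> k; rewrite coefN normrN.
- by move=> k; rewrite coefN normrN.
Qed.

Let horner0_poly N (E : nat -> R) : (\poly_(n < N.+1) E n).[0] = E 0.
Proof. by rewrite horner_coef0 coef_poly. Qed.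

Let G0 N (p1 p2 : {poly R}) : G p1 p2 (c N) (d N) 0 = p1.[0].
Proof.
rewrite /G !horner0_poly invr0 !mulr0 oppr0 expR0 cos0 sin0.
by rewrite mulr0 mulr1 addr0 mul1r.
Qed.

Let squeeze_defect (f : nat -> R) (l : R) :
  (forall N, `|f N - l| <= defect_bound N) -> f @ \oo --> l.
Proof.
move=> fl; apply/cvgrPdist_le => e e0.
near=> N; rewrite distrC (le_trans (fl N))// (le_trans (ler_norm _))//.
near: N; exact: (cvgr0_norm_le _ defect_bound_cvg).
Unshelve. all: by end_near. Qed.

Let Re_G_cvg : (fun N => G (a N) (b N) (c N) (d N) z) @ \oo --> (1 : R).
Proof.
apply: squeeze_defect => N.
rewrite (_ : 1 = G (a N) (b N) (c N) (d N) 0); last first.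
  by rewrite G0 horner0_poly u0.
by apply: ode_defect_bound => // x xz; split;
  [exact: c_le|exact: Re_defect_le|exact: Im_defect_le].
Qed.

(** Replacing (a, b) by (b, - a) is multiplication by - i: it selects the imaginary part and
    exchanges the two defects up to sign. *)
Let Im_G_cvg : (fun N => G (b N) (- a N) (c N) (d N) z) @ \oo --> (0 : R).
Proof.
apply: squeeze_defect => N.
rewrite (_ : 0 = G (b N) (- a N) (c N) (d N) 0); last first.
  by rewrite G0 horner0_poly u0.
apply: ode_defect_bound => // x xz; split; first exact: c_le.
  by rewrite mulrN; exact: Im_defect_le.
rewrite derivN mulrN opprK -normrN -hornerN !opprD !opprK.
exact: Re_defect_le.
Qed.

(** The truncations of Q converge at z, and B exp (- Q) tends to 1; multiplying back by exp Q gives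
    the limit of B. The summand k = 0 of the first series is zero because x / 0 = 0. *)
Lemma exponential_recursion : exists l,
  ccvg (fun N => \sum_(k < N) (z ^+ k / k%:R)%:C * q k.-1) l /\
  ccvg (fun N => \sum_(k < N) (z ^+ k)%:C * u k) (cexp l).
Proof.
have /cvg_ex[/= lc cvg_c] := bounded_coef_cvg z0 z1
  (fun n => div_le1 n (Re_q n.-1)).
have /cvg_ex[/= ld cvg_d] := bounded_coef_cvg z0 z1
  (fun n => div_le1 n (Im_q n.-1)).
exists (lc +i* ld); split.
  split => /=.
    apply: cvg_trans cvg_c; apply: near_eq_cvg; near=> n.
    rewrite Re_sum; apply: eq_bigr => k _; rewrite Re_scale.
    by ring.
  apply: cvg_trans cvg_d; apply: near_eq_cvg; near=> n.
  rewrite Im_sum; apply: eq_bigr => k _; rewrite Im_scale.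
  by ring.
have cN : (fun N => (c N).[z]) @ \oo --> lc.
  under eq_fun do rewrite horner_poly.
  by rewrite -(cvg_shiftS _) /= in cvg_c.
have dN : (fun N => (d N).[z]) @ \oo --> ld.
  under eq_fun do rewrite horner_poly.
  by rewrite -(cvg_shiftS _) /= in cvg_d.
have expN : (fun N => expR (c N).[z]) @ \oo --> expR lc.
  exact: (continuous_cvg _ (@continuous_expR R lc) cN).
have cosN : (fun N => cos (d N).[z]) @ \oo --> cos ld.
  exact: (continuous_cvg _ (@continuous_cos R ld) dN).
have sinN : (fun N => sin (d N).[z]) @ \oo --> sin ld.
  exact: (continuous_cvg _ (@continuous_sin R ld) dN).
have expNK N : expR (c N).[z] * expR (- (c N).[z]) = 1.
  by rewrite expRxMexpNx_1.
split; rewrite -(cvg_shiftS _) /=.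
- rewrite mul0r subr0.
  (* Real part of (a + i b) exp (- (c + i d)) times exp (c + i d); the imaginary part follows in the
     same way. *)
  rewrite (_ : (fun _ => _) = (fun N => expR (c N).[z] *
     (G (a N) (b N) (c N) (d N) z * cos (d N).[z] -
      G (b N) (- a N) (c N) (d N) z * sin (d N).[z]))).
    rewrite -[X in _ --> expR lc * X]subr0 -{1}(mul1r (cos ld)).
    rewrite -(mul0r (sin ld)).
    by apply: cvgM => //; apply: cvgB; apply: cvgM.
  apply/funext => N; transitivity (a N).[z].
    rewrite horner_poly Re_sum; apply: eq_bigr => k _.
    by rewrite Re_scale mulrC.
  rewrite /G hornerN.
  transitivity ((expR (c N).[z] * expR (- (c N).[z])) *
    (a N).[z] * (cos (d N).[z] ^+ 2 + sin (d N).[z] ^+ 2)); last by ring.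
  by rewrite expNK cos2Dsin2 mul1r mulr1.
- rewrite mul0r addr0.
  rewrite (_ : (fun _ => _) = (fun N => expR (c N).[z] *
     (G (a N) (b N) (c N) (d N) z * sin (d N).[z] +
      G (b N) (- a N) (c N) (d N) z * cos (d N).[z]))).
    rewrite -[X in _ --> expR lc * X]addr0 -{1}(mul1r (sin ld)).
    rewrite -(mul0r (cos ld)).
    by apply: cvgM => //; apply: cvgD; apply: cvgM.
  apply/funext => N; transitivity (b N).[z].
    rewrite horner_poly Im_sum; apply: eq_bigr => k _.
    by rewrite Im_scale mulrC.
  rewrite /G hornerN.
  transitivity ((expR (c N).[z] * expR (- (c N).[z])) *
    (b N).[z] * (cos (d N).[z] ^+ 2 + sin (d N).[z] ^+ 2)); last by ring.
  by rewrite expNK cos2Dsin2 mul1r mulr1.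
Unshelve. all: by end_near. Qed.

End exponential_ode.

(** * Complex limits and bounded convergence *)

Section componentwise_convergence.
Variable R : realType.
Implicit Types (s r : nat -> R[i]) (l m : R[i]).

Lemma ccvg_unique s l m : ccvg s l -> ccvg s m -> l = m.
Proof.
move=> [l1 l2] [m1 m2]; apply: complex_eq.
  exact: (cvg_unique _ l1 m1).
exact: (cvg_unique _ l2 m2).
Qed.

Lemma ccvg_cst l : ccvg (fun=> l) l.
Proof. by split; exact: cvg_cst. Qed.

Lemma ccvgD s r l m : ccvg s l -> ccvg r m -> ccvg (fun n => s n + r n) (l + m).
Proof.
move=> [l1 l2] [m1 m2]; rewrite /ccvg ReD ImD.
under eq_fun do rewrite ReD; under [X in _ /\ X @ _ --> _]eq_fun do rewrite ImD.
by split; exact: cvgD.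
Qed.

Lemma ccvgM s r l m : ccvg s l -> ccvg r m -> ccvg (fun n => s n * r n) (l * m).
Proof.
move=> [l1 l2] [m1 m2]; rewrite /ccvg ReM ImM.
under eq_fun do rewrite ReM; under [X in _ /\ X @ _ --> _]eq_fun do rewrite ImM.
by split; [apply: cvgB|apply: cvgD]; exact: cvgM.
Qed.

Lemma ccvgB s r l m : ccvg s l -> ccvg r m -> ccvg (fun n => s n - r n) (l - m).
Proof.
move=> sl /(ccvgM (ccvg_cst (-1))); rewrite mulN1r => /(ccvgD sl).
by under eq_fun do rewrite mulN1r.
Qed.

Lemma ccvgS s l : ccvg (fun n => s n.+1) l <-> ccvg s l.
Proof.
rewrite /ccvg -[in X in _ <-> X](cvg_shiftS (fun n => complex.Re (s n))).
by rewrite -[in X in _ <-> X](cvg_shiftS (fun n => complex.Im (s n))).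
Qed.

Lemma near_eq_ccvg s r l : (\forall n \near \oo, s n = r n) ->
  ccvg s l -> ccvg r l.
Proof.
move=> sr [l1 l2]; split.
  by apply: cvg_trans l1; apply: near_eq_cvg; apply: filterS sr => n ->.
by apply: cvg_trans l2; apply: near_eq_cvg; apply: filterS sr => n ->.
Qed.

Lemma eq_ccvg s r l : s =1 r -> ccvg s l -> ccvg r l.
Proof. by move=> /funext ->. Qed.

Lemma complex_norm_le (x : R[i]) :
  `|x| <= (`|complex.Re x| + `|complex.Im x|)%:C.
Proof.
rewrite normc_def lecR -(@ler_pXn2r _ 2) ?nnegrE ?sqrtr_ge0 ?addr_ge0//.
rewrite sqr_sqrtr ?addr_ge0 ?sqr_ge0// sqrrD !real_normK ?num_real//.
by rewrite addrAC lerDl mulrn_wge0// mulr_ge0.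
Qed.

Lemma ccvg_limn s l : ccvg s l -> limn (fun n => s n : R[i]^o) = l.
Proof.
move=> [l1 l2]; apply/cvg_lim; first exact: norm_hausdorff.
(* A positive element of R[i] has zero imaginary part, so the tolerance is a real number. *)
apply/cvgrPdist_le => -[e ei] /=; rewrite ltcE /= => /andP[/eqP -> e0].
have e20 : 0 < e / 2 by rewrite divr_gt0.
near=> n; apply: le_trans (complex_norm_le _) _.
rewrite -[e +i* 0]/(e%:C) lecR ReD ImD ReN ImN (splitr e) lerD//.
  by near: n; exact: ((cvgrPdist_le _ _).1 l1).
by near: n; exact: ((cvgrPdist_le _ _).1 l2).
Unshelve. all: by end_near. Qed.

Lemma cexpD (x y : R[i]) : cexp (x + y) = cexp x * cexp y.
Proof.
case: x y => [a b] [c d]; rewrite /cexp /= expRD sinD cosD.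
by apply: complex_eq; rewrite /= !(mul0r, addr0, subr0); ring.
Qed.

Lemma cexp0 : cexp 0 = 1 :> R[i].
Proof.
rewrite /cexp /= expR0 cos0 sin0.
by apply: complex_eq; rewrite /= !(mul0r, mulr0, mulr1, subr0, addr0).
Qed.

Lemma cexpN (x : R[i]) : cexp (- x) * cexp x = 1.
Proof. by rewrite -cexpD addNr cexp0. Qed.

End componentwise_convergence.

Section bounded_convergence.
Context d (T : measurableType d) (R : realType) (P : probability T R).

Lemma expect_cvg (f_ : nat -> T -> R) (f : T -> R) (K : R) :
  (forall n, bmf (f_ n)) -> (forall n x, `|f_ n x| <= K) ->
  (forall x, f_ ^~ x @ \oo --> f x) ->
  (fun n => \int[P]_x f_ n x) @ \oo --> \int[P]_x f x.
Proof.
move=> bf fK ff.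
have mf_ n : measurable_fun setT (f_ n) by case: (bf n).
have mf : measurable_fun setT f.
  by apply: (measurable_fun_cvg mf_) => x _; exact: ff.
have fK' x : `|f x| <= K.
  have h : (fun n => `|f_ n x|) @ \oo --> `|f x| by exact: cvg_norm (ff x).
  rewrite -(cvg_lim _ h)//; apply: limr_le; first exact: cvgP h.
  by apply: nearW => n; exact: fK.
have [] := @dominated_convergence _ T R P setT measurableT
  (fun n => EFin \o f_ n) (EFin \o f) (cst K%:E).
- by move=> n; apply/measurable_EFinP.
- exact/measurable_EFinP.
- by apply: aeW => x _; apply/fine_cvgP; split; [exact: nearW|exact: ff].
- exact: (bmf_integrable P (bmf_cst T K)).
- by apply: aeW => x n _; rewrite lee_fin.
move=> _ _ h; apply: fine_cvg.
rewrite fineK; first exact: h.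
apply: integrable_fin_num => //; apply: bmf_integrable.
by split => //; exists K.
Qed.

(** The parts of the partial sums are bounded by 1 / (1 - z), so dominated convergence exchanges sum
    and integral. A sum up to the random time T fits in once T is encoded by indicators in [Y]. *)
Lemma cintegral_series (Y : nat -> T -> R[i]) (z : R) (F : T -> R[i])
    (L : R[i]) : 0 <= z -> z < 1 ->
  (forall k, bmf (fun x => complex.Re (Y k x))) ->
  (forall k, bmf (fun x => complex.Im (Y k x))) ->
  (forall k x, `|complex.Re (Y k x)| <= 1) ->
  (forall k x, `|complex.Im (Y k x)| <= 1) ->
  (forall x, ccvg (fun N => \sum_(k < N) (z ^+ k)%:C * Y k x) (F x)) ->
  ccvg (fun N => \sum_(k < N) (z ^+ k)%:C *
    (\int[P]_x complex.Re (Y k x) +i* \int[P]_x complex.Im (Y k x))) L ->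
  cintegral P setT F = L.
Proof.
move=> z0 z1 bRe bIm Re1 Im1 YF YL; apply: ccvg_unique YL.
have real_part (y : nat -> T -> R) (f : T -> R) :
    (forall k, bmf (y k)) -> (forall k x, `|y k x| <= 1) ->
    (forall x, (fun N => \sum_(k < N) y k x * z ^+ k) @ \oo --> f x) ->
    (fun N => \sum_(k < N) (\int[P]_x y k x) * z ^+ k) @ \oo --> \int[P]_x f x.
  move=> by_ y1 yf.
  rewrite (_ : (fun _ => _) =
    (fun N => \int[P]_x (\sum_(k < N) y k x * z ^+ k))).
    apply: (expect_cvg (K := (1 - z)^-1)) => // n.
      by apply: bmf_sum => k; apply: bmfM => //; exact: bmf_cst.
    move=> x; exact: (bounded_coef_le n z0 z1 (fun k => y1 k x)).
  apply/funext => n; elim: n => [|n ih].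
    rewrite big_ord0 -[LHS](expect_cst P); apply: eq_expect => x.
    by rewrite big_ord0.
  rewrite big_ord_recr /= ih -expectZr// -expectD.
  - by apply: eq_expect => x; rewrite big_ord_recr.
  - by apply: bmf_sum => k; apply: bmfM => //; exact: bmf_cst.
  - by apply: bmfM => //; exact: bmf_cst.
have ReE (e : nat -> R[i]) : (fun N => complex.Re (\sum_(k < N) (z ^+ k)%:C * e k))
    = (fun N => \sum_(k < N) complex.Re (e k) * z ^+ k).
  apply/funext => N; rewrite Re_sum; apply: eq_bigr => k _.
  by rewrite Re_scale mulrC.
have ImE (e : nat -> R[i]) : (fun N => complex.Im (\sum_(k < N) (z ^+ k)%:C * e k))
    = (fun N => \sum_(k < N) complex.Im (e k) * z ^+ k).
  apply/funext => N; rewrite Im_sum; apply: eq_bigr => k _.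
  by rewrite Im_scale mulrC.
pose e k := \int[P]_x complex.Re (Y k x) +i* \int[P]_x complex.Im (Y k x).
split.
  rewrite (ReE e); apply: (real_part (fun k x => complex.Re (Y k x))) => // x.
  by have [+ _] := YF x; rewrite (ReE (fun k => Y k x)).
rewrite (ImE e); apply: (real_part (fun k x => complex.Im (Y k x))) => // x.
by have [_ +] := YF x; rewrite (ImE (fun k => Y k x)).
Qed.

End bounded_convergence.

(** * The Spitzer identity for walks in the plane *)

Section spitzer_identity.
Context d (T : measurableType d) (R : realType) (P : probability T R).
Context dE (E : measurableType dE) (X : nat -> {RV P >-> E}).
Hypotheses (indX : mutually_independent X) (idX : identically_distributed X).
Variable g : E -> R * R.
Hypothesis mg : measurable_fun setT g.
Variable z : R.
Hypotheses (hz0 : 0 < z) (hz1 : z < 1).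

Let W := walk X g.
Let B := alive X g.
Let b := alive_char X g.
Let phi := walk_char X g.
Let q := nonpos_char X g.

Lemma spitzer_generating_functions : exists lQ lP,
  [/\ ccvg (fun N => \sum_(k < N) (z ^+ k / k%:R)%:C * q k) lQ,
      ccvg (fun N => \sum_(k < N) (z ^+ k / k%:R)%:C * (phi k - q k)) lP,
      ccvg (fun N => \sum_(k < N) (z ^+ k)%:C * b k) (cexp lQ) &
      ccvg (fun N => \sum_(k < N) (z ^+ k)%:C *
        (z%:C * (b k * phi 1 - b k.+1))) (1 - cexp (- lP))].
Proof.
have [lQ [cQ cB]] := exponential_recursion (alive_char0 X g)
  (alive_char_recursion indX idX mg)
  (fun n => (alive_char_le X mg n).1) (fun n => (alive_char_le X mg n).2)
  (fun n => (nonpos_char_le X mg n.+1).1) (fun n => (nonpos_char_le X mg n.+1).2)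
  hz0 hz1.
have phi0 : phi 0 = 1 by rewrite /phi (walk_charX indX idX mg) expr0.
have [lF [cF cG]] := exponential_recursion phi0
  (walk_char_recursion indX idX mg)
  (fun n => (walk_char_le X mg n).1) (fun n => (walk_char_le X mg n).2)
  (fun n => (walk_char_le X mg n.+1).1) (fun n => (walk_char_le X mg n.+1).2)
  hz0 hz1.
(* [exponential_recursion] is applied to the sequence shifted by one; the two indexings differ only
   at k = 0, where division by zero kills the term. *)
have pred_index (f : nat -> R[i]) N :
    \sum_(k < N) (z ^+ k / k%:R)%:C * f k.-1.+1 =
    \sum_(k < N) (z ^+ k / k%:R)%:C * f k.
  apply: eq_bigr => -[[|k] kN] _ //=.
  by rewrite invr0 mulr0 !mul0r.
have cQ' : ccvg (fun N => \sum_(k < N) (z ^+ k / k%:R)%:C * q k) lQ.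
  by apply: eq_ccvg cQ => N; exact: (pred_index q).
have cF' : ccvg (fun N => \sum_(k < N) (z ^+ k / k%:R)%:C * phi k) lF.
  by apply: eq_ccvg cF => N; exact: (pred_index phi).
(* Splitting off the first term shows that [cexp lF] is inverse to 1 - z phi, without assuming
   beforehand that the latter is nonzero. *)
have geometric : cexp lF = 1 + z%:C * phi 1 * cexp lF.
  apply: (@ccvg_unique _ (fun N => \sum_(k < N.+1) (z ^+ k)%:C * phi k)).
    exact/(ccvgS (fun N => \sum_(k < N) (z ^+ k)%:C * phi k)).
  apply: eq_ccvg (ccvgD (ccvg_cst 1) (ccvgM (ccvg_cst (z%:C * phi 1)) cG)) => N.
  rewrite big_ord_recl /= phi0 mulr1; congr (_ + _).
  rewrite mulr_sumr; apply: eq_bigr => k _.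
  rewrite /phi (walk_charX indX idX mg k) (walk_charX indX idX mg (bump 0 k)).
  by rewrite [in RHS]exprS rmorphM /= exprS; ring.
exists lQ, (lF - lQ); split => //.
  apply: eq_ccvg (ccvgB cF' cQ') => N.
  by rewrite -sumrB; apply: eq_bigr => k _; rewrite mulrBr.
have -> : 1 - cexp (- (lF - lQ)) = z%:C * phi 1 * cexp lQ - (cexp lQ - 1).
  have -> : cexp (- (lF - lQ)) = cexp lQ * (1 - z%:C * phi 1).
    rewrite opprB cexpD; congr (_ * _).
    have h : cexp lF * (1 - z%:C * phi 1) = 1.
      by rewrite mulrBr mulr1 {1}geometric; ring.
    by rewrite -[cexp (- lF)]mulr1 -[X in _ * X = _]h mulrA cexpN mul1r.
  by ring.
have cBS : ccvg (fun N => \sum_(k < N.+1) (z ^+ k)%:C * b k) (cexp lQ).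
  exact/(ccvgS (fun N => \sum_(k < N) (z ^+ k)%:C * b k)).
apply: eq_ccvg (ccvgB (ccvgM (ccvg_cst (z%:C * phi 1)) cB)
  (ccvgB cBS (ccvg_cst 1))) => N.
rewrite big_ord_recl /= expr0 /b alive_char0 mulr1 rmorph1 addrAC subrr add0r.
rewrite mulr_sumr -sumrB; apply: eq_bigr => k _.
by rewrite exprS rmorphM /=; ring.
Qed.

Variable S : nat -> T -> R.
Hypothesis SE : forall n x, S n x = (W n x).1.

(** The dictionary between [ladder_time] and the indicators: [B k] is the indicator of k < T,
    infinite T included. *)
Lemma ladder_alive x :
  if ladder_time S x is Some m
  then (0 < m)%N /\ forall k, B k x = (k < m)%N%:R
  else forall k, B k x = 1.
Proof.
rewrite /ladder_time; case: pselect => [ex|nex].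
  case: ex_minnP => m /andP[m0 Sm] minm; split => // k.
  rewrite /B /alive; have [km|mk] := ltnP k m.
    rewrite big1// => j _; rewrite /nonpos.
    have [//|Sj] := leP; have := minm j.+1; rewrite SE Sj /= => /(_ isT).
    by move=> /(leq_trans km); rewrite ltnNge ltn_ord.
  have mk' : (m.-1 < k)%N by rewrite prednK.
  rewrite (bigD1 (Ordinal mk'))//= prednK// /nonpos.
  by move: Sm; rewrite SE ltNge => /negbTE ->; rewrite mul0r.
move=> k; rewrite /B /alive big1// => j _; rewrite /nonpos.
have [//|Sj] := leP; exfalso; apply: nex; exists j.+1.
by rewrite /= SE.
Qed.

Let char n x : R[i] := cos (W n x).2 +i* sin (W n x).2.

Lemma ladder_generating_function lP :
  ccvg (fun N => \sum_(k < N) (z ^+ k)%:C *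
    (z%:C * (b k * phi 1 - b k.+1))) lP ->
  cintegral P setT (fun x => if ladder_time S x is Some n
                    then z%:C ^+ n * char n x else 0) = lP.
Proof.
move=> cP.
(* The indicator of T = k+1: at most one term of the series survives, at k = T - 1, and the extra
   factor z raises z^k to z^T. *)
pose dead k x := B k x - B k.+1 x.
have dead_le k x : `|z * dead k x| <= 1.
  have /andP[B0 B1] := alive_itv X g k x.
  have /andP[C0 C1] := alive_itv X g k.+1 x.
  rewrite normrM mulr_ile1//; first by rewrite ger0_norm ltW.
  by rewrite ler_norml /dead /B; lra.
have bdead k : bmf (fun x => z * dead k x).
  apply: bmfM; first exact: bmf_cst.
  by apply: bmfB; exact: (alive_bmf X mg).
apply: (@cintegral_series _ _ _ P
  (fun k x => (z * dead k x)%:C * char k.+1 x) z) => //.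
- exact: ltW.
- move=> k; under eq_fun do rewrite Re_scale.
  by apply: bmfM => //; exact: (cos_walk_bmf X mg).
- move=> k; under eq_fun do rewrite Im_scale.
  by apply: bmfM => //; exact: (sin_walk_bmf X mg).
- by move=> k x; rewrite Re_scale normrM mulr_ile1//= ler_norml cos_geN1 cos_le1.
- by move=> k x; rewrite Im_scale normrM mulr_ile1//= ler_norml sin_geN1 sin_le1.
- move=> x; have := ladder_alive x; case: ladder_time => [m [m0 Bm]|B1].
    apply: near_eq_ccvg (ccvg_cst _); near=> N.
    have mN : (m.-1 < N)%N by rewrite prednK//; near: N; exact: nbhs_infty_ge.
    rewrite (bigD1 (Ordinal mN))//= prednK// big1 ?addr0.
      rewrite /dead !Bm prednK// ltnn leqnn subr0 mulr1 mulrA -rmorphM /=.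
      by rewrite -exprSr prednK// rmorphXn.
    move=> k km; rewrite /dead !Bm.
    have -> : (k < m)%N = (k.+1 < m)%N.
      apply/idP/idP => h; last by lia.
      by move: km; rewrite -val_eqE /= => km; lia.
    by rewrite subrr mulr0 mul0r mulr0.
  apply: eq_ccvg (ccvg_cst 0) => N; rewrite big1// => k _.
  by rewrite /dead !B1 subrr mulr0 mul0r mulr0.
- apply: eq_ccvg cP => N; apply: eq_bigr => k _; congr (_ * _).
  rewrite /b /phi (alive_char_next indX idX mg).
  have bcos i j : bmf (fun x => B i x * cos (W j x).2).
    by apply: bmfM; [exact: (alive_bmf X mg)|exact: (cos_walk_bmf X mg)].
  have bsin i j : bmf (fun x => B i x * sin (W j x).2).
    by apply: bmfM; [exact: (alive_bmf X mg)|exact: (sin_walk_bmf X mg)].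
  apply: complex_eq; rewrite ?Re_scale ?Im_scale /=.
    rewrite -expectB// -expectZl; last exact: bmfB.
    by apply: eq_expect => x; rewrite /dead /W /B /=; ring.
  rewrite -expectB// -expectZl; last exact: bmfB.
  by apply: eq_expect => x; rewrite /dead /W /B /=; ring.
Unshelve. all: by end_near. Qed.

(** [B k] cuts the series off at T; for infinite T it leaves the full series, whose componentwise
    limit is identified with [cseries_sum]. *)
Lemma alive_generating_function lQ :
  ccvg (fun N => \sum_(k < N) (z ^+ k)%:C * b k) lQ ->
  cintegral P setT (fun x => if ladder_time S x is Some m
    then \sum_(0 <= n < m) z%:C ^+ n * char n x
    else cseries_sum 0 (fun n => z%:C ^+ n * char n x)) = lQ.
Proof.
move=> cQ.
have cos1 n x : `|cos (W n x).2| <= 1 by rewrite ler_norml cos_geN1 cos_le1.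
have sin1 n x : `|sin (W n x).2| <= 1 by rewrite ler_norml sin_geN1 sin_le1.
have B1 n x : `|B n x| <= 1.
  by have /andP[? ?] := alive_itv X g n x; rewrite /B ger0_norm.
apply: (@cintegral_series _ _ _ P (fun k x => (B k x)%:C * char k x) z) => //.
- exact: ltW.
- move=> k; under eq_fun do rewrite Re_scale.
  by apply: bmfM; [exact: (alive_bmf X mg)|exact: (cos_walk_bmf X mg)].
- move=> k; under eq_fun do rewrite Im_scale.
  by apply: bmfM; [exact: (alive_bmf X mg)|exact: (sin_walk_bmf X mg)].
- by move=> k x; rewrite Re_scale normrM mulr_ile1//=.
- by move=> k x; rewrite Im_scale normrM mulr_ile1//=.
- move=> x; have := ladder_alive x; case: ladder_time => [m [m0 Bm]|Bx].
    apply: near_eq_ccvg (ccvg_cst _); near=> N.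
    have mN : (m <= N)%N by near: N; exact: nbhs_infty_ge.
    rewrite big_mkord (big_ord_widen _ (fun n => z%:C ^+ n * char n x) mN).
    rewrite big_mkcond; apply: eq_bigr => k _; rewrite Bm.
    by case: ifP => _; rewrite ?mul1r ?mul0r ?mulr0// rmorphXn.
  have partial N : \sum_(k < N) (z ^+ k)%:C * ((B k x)%:C * char k x) =
      \sum_(0 <= k < N) z%:C ^+ k * char k x.
    rewrite big_mkord; apply: eq_bigr => k _.
    by rewrite Bx mul1r rmorphXn.
  have /cvg_ex[/= lc cvg_c] := bounded_coef_cvg (ltW hz0) hz1 (fun n => cos1 n x).
  have /cvg_ex[/= ls cvg_s] := bounded_coef_cvg (ltW hz0) hz1 (fun n => sin1 n x).
  have c : ccvg (fun N => \sum_(0 <= k < N) z%:C ^+ k * char k x) (lc +i* ls).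
    split => /=.
      apply: cvg_trans cvg_c; apply: near_eq_cvg; apply: nearW => N.
      rewrite big_mkord Re_sum; apply: eq_bigr => k _.
      by rewrite -rmorphXn Re_scale mulrC.
    apply: cvg_trans cvg_s; apply: near_eq_cvg; apply: nearW => N.
    rewrite big_mkord Im_sum; apply: eq_bigr => k _.
    by rewrite -rmorphXn Im_scale mulrC.
  by rewrite /cseries_sum (ccvg_limn c); apply: eq_ccvg c => N; rewrite partial.
- apply: eq_ccvg cQ => N; apply: eq_bigr => k _; congr (_ * _).
  by apply: complex_eq => /=; apply: eq_expect => x; rewrite /W /B /=; ring.
Unshelve. all: by end_near. Qed.

End spitzer_identity.

(** * The joint control-cost process *)

Section increments.
Variables (R : realType) (l : nat).

Lemma measurable_row_coord (i : 'I_l) :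
  measurable_fun setT (fun v : 'rV[R]_l => v ord0 i).
Proof.
move=> _ A mA; rewrite setTI; apply: sub_sigma_algebra => /=.
rewrite -bigcup_seq/=; exists i => /=; first by rewrite mem_index_enum.
by exists A => //; rewrite setTI.
Qed.

Lemma measurable_dotmul (s : 'rV[R]_l) : measurable_fun setT (dotmul s).
Proof.
apply: measurable_sum => i; apply: measurable_funM => //.
exact: measurable_row_coord.
Qed.

Lemma dotmul_sumr (s : 'rV[R]_l) (I : Type) (r : seq I) (F : I -> 'rV[R]_l) :
  dotmul s (\sum_(k <- r) F k) = \sum_(k <- r) dotmul s (F k).
Proof.
apply: (big_morph (dotmul s)) => [u v|].
  by rewrite /dotmul -big_split; apply: eq_bigr => i _; rewrite mxE mulrDr.
by rewrite /dotmul big1// => i _; rewrite mxE mulr0.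
Qed.

(** The first coordinate is kept for its sign, the second is the exponent of the character; both are
    additive in the increment. *)
Definition control_phase (t : R) (s : 'rV[R]_l) (x : R * 'rV[R]_l) : R * R :=
  (x.1, t * x.1 + dotmul s x.2).

Lemma measurable_control_phase t s : measurable_fun setT (control_phase t s).
Proof.
apply: measurable_fun_pair => //; apply: measurable_funD.
  exact: measurable_funM.
by apply: measurableT_comp measurable_snd; exact: measurable_dotmul.
Qed.

End increments.

Theorem theorem2p1 (R : realType) (d : measure_display) (T : measurableType d)
    (P : probability T R) (l : nat)
    (S : nat -> T -> R) (C : nat -> T -> 'rV[R]_l)
    (hSC : iid_increments P S C)
    (t : R) (s : 'rV[R]_l) (z : R) (hz0 : 0 < z) (hz1 : z < 1) :
  cintegral P setT
    (fun x => if ladder_time S x is Some n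
              then z%:C ^+ n * joint_char S C t s n x
              else 0)
  = 1 - cexp (- cseries_sum 1 (fun n =>
          z%:C ^+ n / n%:R *
          cintegral P [set x | 0 < S n x] (joint_char S C t s n)))
  /\
  cintegral P setT
    (fun x => if ladder_time S x is Some m
              then \sum_(0 <= n < m) z%:C ^+ n * joint_char S C t s n x
              else cseries_sum 0 (fun n => z%:C ^+ n * joint_char S C t s n x))
  = cexp (cseries_sum 1 (fun n =>
          z%:C ^+ n / n%:R *
          cintegral P [set x | S n x <= 0] (joint_char S C t s n))).
Proof.
case: hSC => X [indX idX SX CX].
pose g := control_phase t s.
have mg : measurable_fun setT g := measurable_control_phase t s.
have walkE n x : walk X g n x = (S n x, t * S n x + dotmul s (C n x)).
  rewrite SX CX dotmul_sumr mulr_sumr -big_split /walk.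
  have -> (F : 'I_n -> R * R) : \sum_k F k = (\sum_k (F k).1, \sum_k (F k).2).
    by rewrite [LHS]surjective_pairing; congr (_, _);
      [apply: (big_morph fst)|apply: (big_morph snd)].
  by [].
have SE n x : S n x = (walk X g n x).1 by rewrite walkE.
have charE : joint_char S C t s = (fun n x =>
    cos (walk X g n x).2 +i* sin (walk X g n x).2).
  apply/funext => n; apply/funext => x.
  rewrite /joint_char -cexpD walkE /cexp /= !addr0 expR0.
  by apply: complex_eq; rewrite /= !(mul1r, mul0r, subr0, addr0).
(* Starting at 0 instead of 1 adds a term divided by 0, that is 0, so [f] and [h] are compared from
   index 1 on. *)
have sumE (f h : nat -> R[i]) : (forall k, f k.+1 = h k.+1) ->
  cseries_sum 1 (fun n => z%:C ^+ n / n%:R * f n) =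
  limn (fun N => \sum_(k < N) (z ^+ k / k%:R)%:C * h k : R[i]^o).
  move=> fh; apply: (congr1 (fun u : nat -> R[i]^o => limn u)); apply/funext => -[|N].
    by rewrite big_geq// big_ord0.
  rewrite big_add1 big_mkord big_ord_recl /= invr0 mulr0 mul0r add0r.
  apply: eq_bigr => k _; rewrite fh; congr (_ * _).
  by rewrite rmorphM rmorphXn fmorphV rmorph_nat.
have nonposE n : cintegral P [set x | S n x <= 0] (joint_char S C t s n) =
    nonpos_char X g n.
  rewrite charE /cintegral /nonpos_char !(Rintegral_mkcond P [set x | S n x <= 0]).
  have restrictE (f : T -> R) x : (f \_ [set x | S n x <= 0]) x =
      nonpos (walk X g n x) * f x.
    rewrite patchE /nonpos -SE.
    case: (boolP (x \in [set x | S n x <= 0])) => [/set_mem /= -> |].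
      by rewrite /= mul1r.
    by rewrite notin_setE /= => /negP/negbTE ->; rewrite /= mul0r.
  by congr (_ +i* _); apply: eq_expect => x; rewrite restrictE.
(* The indicator of S_n > 0 is 1 - [nonpos]; hence the series with coefficients phi^n - q_n in
   [spitzer_generating_functions]. *)
have posE n : cintegral P [set x | 0 < S n x] (joint_char S C t s n) =
    walk_char X g n - nonpos_char X g n.
  rewrite charE /cintegral !(Rintegral_mkcond P [set x | 0 < S n x]).
  have restrictE (f : T -> R) x : (f \_ [set x | 0 < S n x]) x =
      f x - nonpos (walk X g n x) * f x.
    rewrite patchE /nonpos -SE leNgt.
    case: (boolP (x \in [set x | 0 < S n x])) => [/set_mem /= -> |].
      by rewrite /= mul0r subr0.
    by rewrite notin_setE /= => /negP/negbTE ->; rewrite /= mul1r subrr.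
  have bn := nonpos_walk_bmf X mg n.
  have bc := cos_walk_bmf X mg n.
  have bs := sin_walk_bmf X mg n.
  apply: complex_eq => /=.
    rewrite -(expectB P bc (bmfM bn bc)).
    by apply: eq_expect => x; rewrite restrictE.
  rewrite -(expectB P bs (bmfM bn bs)).
  by apply: eq_expect => x; rewrite restrictE.
have [lQ [lP [cQ cP cB cA]]] :=
  spitzer_generating_functions indX idX mg hz0 hz1.
split.
  rewrite (sumE _ (fun n => walk_char X g n - nonpos_char X g n)) => [|k].
    rewrite (ccvg_limn cP) -(ladder_generating_function indX idX mg hz0 hz1 SE cA).
    by rewrite charE.
  exact: posE.
rewrite (sumE _ (nonpos_char X g)) => [|k]; last exact: nonposE.
rewrite (ccvg_limn cQ) -(alive_generating_function mg hz0 hz1 SE cB).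
by rewrite charE.
Qed.
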